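(* Consider the controlled stochastic wave equation $$\begin{cases} dy_t-\sum_{j,k=1}^n(a^{jk}y_{x_j})_{x_k}dt=(a_1\cdot\nabla y+a_2y+g_1)\,dt+(a_3y+g_2)\,dW(t) & \text{in }Q,\\ y=\chi_{\Sigma_0}h & \text{on }\Sigma,\\ y(0)=y_0,\quad y_t(0)=y_1 & \text{in }G,\end{cases}$$ with controls $g_1,g_2\in L^2_{\mathbb F}(0,T;H^{-1}(G))$ and $h\in L^2_{\mathbb F}(0,T;L^2(\Gamma_0))$. For every $T>0$ and every nonempty (measurable) subset $\Gamma_0\subset\Gamma$, this system is not exactly controllable at time $T$.
   Context: Notation. $G\subset\mathbb R^n$ is a bounded domain with $C^2$ boundary $\Gamma$ and unit outward normal $\nu$; $Q=(0,T)\times G$, $\Sigma=(0,T)\times\Gamma$, $\Sigma_0=(0,T)\times\Gamma_0$. $(\Omega,\mathcal F,\mathbb F,\mathbb P)$ is a complete filtered probability space, $\mathbb F=\{\mathcal F_t\}_{t\ge 0}$ being the natural filtration generated by a one-dimensional standard Brownian motion $W$. For a Banach space $H$: $L^2_{\mathbb F}(0,T;H)$ is the space of $H$-valued $\mathbb F$-adapted processes $X$ with $\mathbb E|X|^2_{L^2(0,T;H)}<\infty$; $L^\infty_{\mathbb F}(0,T;H)$ is the space of $H$-valued $\mathbb F$-adapted essentially bounded processes; $C_{\mathbb F}([0,T];L^r(\Omega;H))$ is the space of $H$-valued $\mathbb F$-adapted processes $X$ such that $X:[0,T]\to L^r_{\mathcal F_T}(\Omega;H)$ is continuous, and $C^1_{\mathbb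 F}([0,T];L^r(\Omega;H))$ is defined similarly; $L^2_{\mathcal F_t}(\Omega;H)$ is the space of $\mathcal F_t$-measurable square integrable $H$-valued random variables. Standing assumptions. $(a^{jk})_{1\le j,k\le n}\in C^3(\overline G;\mathbb R^{n\times n})$, $a^{jk}=a^{kj}$, and for some $s_0>0$, $\sum_{j,k}a^{jk}(x)\xi^j\xi^k\ge s_0|\xi|^2$ for all $(x,\xi)\in G\times\mathbb R^n$; $a_1\in L^\infty_{\mathbb F}(0,T;W^{1,\infty}(G;\mathbb R^n))$, $a_2,a_3\in L^\infty_{\mathbb F}(0,T;L^\infty(G))$. Solutions. For $(y_0,y_1)\in L^2(G)\times H^{-1}(G)$, a solution (in the transposition sense) is a process $y\in C_{\mathbb F}([0,T];L^2(\Omega;L^2(G)))\cap C^1_{\mathbb F}([0,T];L^2(\Omega;H^{-1}(G)))$ such that for every $\tau\in(0,T]$ and $(z^\tau,\hat z^\tau)\in L^2_{\mathcal F_\tau}(\Omega;H^1_0(G))\times L^2_{\mathcal F_\tau}(\Omega;L^2(G))$, $$\begin{aligned}&\mathbb E\langle y_t(\tau),z^\tau\rangle_{H^{-1},H^1_0}-\langle y_1,z(0)\rangle_{H^{-1},H^1_0}-\mathbb E\langle y(\tau),\hat z^\tau\rangle_{L^2(G)}+\langle y_0,\hat z(0)\rangle_{L^2(G)}\\&=\mathbb E\int_0^\tau\langle g_1,z\rangle_{H^{-1},H^1_0}dt+\mathbb E\int_0^\tau\langle g_2,Z\rangle_{H^{-1},H^1_0}dt-\mathbb E\int_0^\tau\int_{\Gamma_0}\frac{\partial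 z}{\partial\nu}h\,d\Gamma\,dt,\end{aligned}$$ where $(z,Z,\hat z,\widehat Z)\in C_{\mathbb F}([0,\tau];L^2(\Omega;H^1_0(G)))\times L^2_{\mathbb F}(0,\tau;H^1_0(G))\times C_{\mathbb F}([0,\tau];L^2(\Omega;L^2(G)))\times L^2_{\mathbb F}(0,\tau;L^2(G))$ is the unique weak solution of the backward equation on $(0,\tau)\times G$ $$dz=\hat z\,dt+Z\,dW,\quad d\hat z-\sum_{j,k}(a^{jk}z_{x_j})_{x_k}dt=\big(-a_1\cdot\nabla z+(-\mathrm{div}\,a_1+a_2)z+a_3Z\big)dt+\widehat Z\,dW,\quad z|_{(0,\tau)\times\Gamma}=0,\quad (z,\hat z)(\tau)=(z^\tau,\hat z^\tau).$$ (The normal derivative of $z$ on $\Gamma$ belongs to $L^2_{\mathbb F}(0,\tau;L^2(\Gamma))$.) Exact controllability. The system is called exactly controllable at time $T$ if for any $(y_0,y_1)\in L^2(G)\times H^{-1}(G)$ and any $(y_0',y_1')\in L^2_{\mathcal F_T}(\Omega;L^2(G))\times L^2_{\mathcal F_T}(\Omega;H^{-1}(G))$ there are controls $(g_1,g_2,h)\in L^2_{\mathbb F}(0,T;H^{-1}(G))\times L^2_{\mathbb F}(0,T;H^{-1}(G))\times L^2_{\mathbb F}(0,T;L^2(\Gamma_0))$ such that the corresponding solution satisfies $(y(T),y_t(T))=(y_0',y_1')$. *)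

(* Defs.v *)
From HB Require Import structures.
From mathcomp Require Import all_boot all_order all_algebra.
From mathcomp Require Import all_classical all_reals all_analysis.

Set Implicit Arguments.
Unset Strict Implicit.
Unset Printing Implicit Defensive.
Import Order.TTheory GRing.Theory Num.Theory.
Import numFieldNormedType.Exports.
Local Open Scope classical_set_scope.
Local Open Scope ring_scope.

Definition rV_display : measure_display. Proof. exact: default_measure_display. Qed.

Section RowMeasurable.
Context {R : realType} {n : nat}.

Definition rV_coord (i : 'I_n) (x : 'rV[R]_n) : measurableTypeR R := x ord0 i.

Let rV_meas := g_sigma_preimage rV_coord.

Let rV_meas0 : rV_meas set0.
Proof. exact: sigma_algebra0. Qed.

Let rV_measC A : rV_meas A -> rV_meas (~` A).
Proof. exact: sigma_algebraC. Qed.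

Let rV_meas_bigcup (F : (set 'rV[R]_n)^nat) :
  (forall i, rV_meas (F i)) -> rV_meas (\bigcup_i F i).
Proof. exact: sigma_algebra_bigcup. Qed.

(* The sigma-algebra generated by the coordinates, i.e. the Borel sets. *)
HB.instance Definition _ := @isMeasurable.Build rV_display 'rV[R]_n
  rV_meas rV_meas0 rV_measC rV_meas_bigcup.

End RowMeasurable.

Lemma measurable_fun_rV {R : realType} d (T : measurableType d) n
    (f : T -> 'rV[R]_n) :
  (forall i, measurable_fun [set: T] (fun x => f x ord0 i : measurableTypeR R)) ->
  measurable_fun [set: T] f.
Proof.
move=> mf; have sub : g_sigma_preimage (@rV_coord R n) `<=`
    [set A | measurable (f @^-1` A)].
  apply: smallest_sub.
    split; first by rewrite /= preimage_set0; exact: measurable0.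
    - by move=> A /= mA; rewrite setTD preimage_setC; exact: measurableC.
    - by move=> F /= mF; rewrite preimage_bigcup; exact: bigcup_measurable.
  case: n => [|n] in f mf *; first by rewrite big_ord0.
  rewrite -bigcup_mkord_ord; apply: bigcup_sub => i Ii A [B mB <-] /=.
  by rewrite setTI -comp_preimage -[X in measurable X]setTI; exact: mf.
by move=> _ A mA; rewrite setTI; exact: sub.
Qed.

Section ProductSigmaFinite.
Local Open Scope ereal_scope.
Context d1 d2 (T1 : measurableType d1) (T2 : measurableType d2) {R : realType}.
Variable m1 : {sigma_finite_measure set T1 -> \bar R}.
Variable m2 : {sigma_finite_measure set T2 -> \bar R}.

(* A copy of [m1 \x m2]: on [m1 \x m2] itself the library's sigma-finiteness
   instance is shadowed by the one for sub-probabilities. *)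
Definition prod_measure : set (T1 * T2)%type -> \bar R := m1 \x m2.

Let prod_measure0 : prod_measure set0 = 0.
Proof. exact: measure0. Qed.

Let prod_measure_ge0 A : 0 <= prod_measure A.
Proof. exact: measure_ge0. Qed.

Let prod_measure_sigma_additive : semi_sigma_additive prod_measure.
Proof. exact: measure_semi_sigma_additive. Qed.

HB.instance Definition _ := isMeasure.Build _ _ _ prod_measure
  prod_measure0 prod_measure_ge0 prod_measure_sigma_additive.

Let prod_measure_sigma_finite : sigma_finite setT prod_measure.
Proof.
have /sigma_finiteP[F [TF ndF Foo]] := sigma_finiteT m1.
have /sigma_finiteP[G [TG ndG Goo]] := sigma_finiteT m2.
exists (fun n => F n `*` G n).
  rewrite -setXTT TF TG predeqE => -[x y]; split.
    move=> [/= [n _ Fnx] [k _ Gky]]; exists (maxn n k) => //; split.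
    - by move: x Fnx; exact/subsetPset/ndF/leq_maxl.
    - by move: y Gky; exact/subsetPset/ndG/leq_maxr.
  by move=> [n _ []/= ? ?]; split; exists n.
move=> k; have [? ?] := Foo k; have [? ?] := Goo k.
split; first exact: measurableX.
by rewrite /prod_measure product_measure1E// lte_mul_pinfty// ge0_fin_numE.
Qed.

HB.instance Definition _ := Measure_isSigmaFinite.Build _ _ _ prod_measure
  prod_measure_sigma_finite.

End ProductSigmaFinite.

Section LebesgueRow.
Context {R : realType}.

(* The iterated product R * (R * ...) with its product measure, and its
   identification with row vectors. *)
Record prod_space (n : nat) := ProdSpace {
  ps_display : measure_display;
  ps_type : measurableType ps_display;
  ps_measure : {sigma_finite_measure set ps_type -> \bar R};
  ps_row : ps_type -> 'rV[R]_n;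
  ps_row_meas : measurable_fun setT ps_row }.

Let row0 (_ : unit) : 'rV[R]_0 := 0.

Let row0_meas : measurable_fun setT row0.
Proof. exact: measurable_cst. Qed.

Definition prod_space0 : prod_space 0 :=
  @ProdSpace 0 _ unit (dirac tt : {sigma_finite_measure set unit -> \bar R}) row0 row0_meas.

Section Step.
Variables (n : nat) (S : prod_space n).

Definition row_cons (p : measurableTypeR R * ps_type S) : 'rV[R]_n.+1 :=
  \row_(i < n.+1) (if unlift ord0 i is Some j then ps_row p.2 ord0 j else p.1).

Let row_cons_meas : measurable_fun setT row_cons.
Proof.
apply: measurable_fun_rV => i; rewrite /row_cons.
case: (unliftP ord0 i) => [j|] ->.
  have mj : measurable_fun setT (fun y : 'rV[R]_n => y ord0 j : measurableTypeR R).
    case: (n) j => [[]//|m j] _ Y mY; rewrite setTI; apply: sub_sigma_algebra.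
    rewrite -bigcup_mkord_ord; exists j => /=; first exact: ltn_ord.
    by exists Y => //; rewrite setTI inord_val.
  rewrite (_ : (fun x => _) = (fun y : 'rV[R]_n => y ord0 j) \o (@ps_row _ S \o snd)).
    by apply: (measurableT_comp mj); apply: (measurableT_comp (@ps_row_meas _ S)).
  by apply/funext => x /=; rewrite mxE liftK.
rewrite (_ : (fun x => _) = fst); first exact: measurable_fst.
by apply/funext => x /=; rewrite mxE unlift_none.
Qed.

Definition prod_spaceS : prod_space n.+1 :=
  @ProdSpace n.+1 _ (measurableTypeR R * ps_type S)%type
    (prod_measure (@lebesgue_measure R) (ps_measure S))
    row_cons row_cons_meas.

End Step.

Fixpoint prod_space_of (n : nat) : prod_space n :=
  if n is m.+1 then prod_spaceS (prod_space_of m) else prod_space0.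

Definition lebesgue_rV (n : nat) : {measure set 'rV[R]_n -> \bar R} :=
  measure_function_pushforward__canonical__measure_function_Measure
    (ps_measure (prod_space_of n)) (@ps_row_meas n (prod_space_of n)).

End LebesgueRow.

(* The library norm of ['rV[R]_n] is the sup norm. *)
Definition enorm {R : realType} n (x : 'rV[R]_n) : R :=
  Num.sqrt (\sum_i (x ord0 i) ^+ 2).

Definition edot {R : realType} n (x y : 'rV[R]_n) : R :=
  \sum_i x ord0 i * y ord0 i.

Section Hausdorff.
Local Open Scope ereal_scope.
Context {R : realType} (n s : nat).

Definition ediam (U : set 'rV[R]_n) : \bar R :=
  ereal_sup [set (enorm (p.1 - p.2)%R)%:E | p in U `*` U].

Definition unit_ball_volume : R :=
  fine (lebesgue_rV s [set x : 'rV[R]_s | enorm x <= 1]%R).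

(* [alpha(s) (diam U / 2)^s], where [alpha(s)] is the volume of the unit ball
   of [R^s]; the empty set has gauge 0 also when [s = 0]. The absolute value
   is that of a nonnegative number. *)
Definition hausdorff_gauge (delta : R) (U : set 'rV[R]_n) : \bar R :=
  if U == set0 then 0
  else if ediam U <= delta%:E
       then `|unit_ball_volume * (fine (ediam U) / 2) ^+ s|%:E
       else +oo.

Definition hausdorff_pre (delta : R) : set 'rV[R]_n -> \bar R :=
  @mu_ext _ (g_sigma_algebraType [set: set 'rV[R]_n]) R (hausdorff_gauge delta).

Definition hausdorff (A : set 'rV[R]_n) : \bar R :=
  ereal_sup [set hausdorff_pre delta A | delta in [set delta : R | (0 < delta)%R]].

Let gauge0 delta : hausdorff_gauge delta set0 = 0.
Proof. by rewrite /hausdorff_gauge eqxx. Qed.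

Let gauge_ge0 delta U : 0 <= hausdorff_gauge delta U.
Proof.
by rewrite /hausdorff_gauge; case: ifP => // _; case: ifP => // _; rewrite lee_fin.
Qed.

Let hausdorff_pre_le delta A : (0 < delta)%R -> hausdorff_pre delta A <= hausdorff A.
Proof. by move=> d0; apply: ereal_sup_ubound; exists delta. Qed.

Let hausdorff_ge0 A : 0 <= hausdorff A.
Proof.
apply: le_trans (@hausdorff_pre_le 1%R A ltr01).
by apply: mu_ext_ge0 => U; exact: gauge_ge0.
Qed.

Let hausdorff0 : hausdorff set0 = 0.
Proof.
apply/eqP; rewrite eq_le hausdorff_ge0 andbT.
apply: ge_ereal_sup => _ [delta _ <-]; rewrite /hausdorff_pre mu_ext0//.
Qed.

Let le_hausdorff : {homo hausdorff : A B / A `<=` B >-> A <= B}.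
Proof.
move=> A B AB; apply: ge_ereal_sup => _ [delta d0 <-].
by apply: le_trans (hausdorff_pre_le _ d0); apply: le_mu_ext.
Qed.

Let hausdorff_sigma_subadditive : sigma_subadditive hausdorff.
Proof.
move=> F; apply: ge_ereal_sup => _ [delta d0 <-].
apply: (le_trans (@mu_ext_sigma_subadditive _
  (g_sigma_algebraType [set: set 'rV[R]_n]) R _ (gauge_ge0 delta) F)).
apply: lee_nneseries => k _; first by move=> _; apply: mu_ext_ge0; exact: gauge_ge0.
exact: hausdorff_pre_le.
Qed.

HB.instance Definition _ := isOuterMeasure.Build R 'rV[R]_n hausdorff
  hausdorff0 hausdorff_ge0 le_hausdorff hausdorff_sigma_subadditive.

End Hausdorff.

Definition surface_outer (R : realType) (n : nat) :
  {outer_measure set 'rV[R]_n -> \bar R} := @hausdorff R n n.-1.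

(* [R^n] with the sigma-algebra of the Caratheodory-measurable sets of the
   (n-1)-dimensional Hausdorff measure. *)
Notation surf_space R n := (caratheodory_type (surface_outer R n)).

Definition surface_measurable {R : realType} {n : nat} : set (set 'rV[R]_n) :=
  @measurable _ (surf_space R n).

Definition surface {R : realType} {n : nat} :
    {measure set (surf_space R n) -> \bar R} := surface_outer R n.

Definition basis_row {R : realType} {n} (i : 'I_n) : 'rV[R]_n := delta_mx ord0 i.

Definition grad {R : realType} {n} (f : 'rV[R]_n -> R) (x : 'rV[R]_n) : 'rV[R]_n :=
  \row_i 'D_(basis_row i) f x.

(* [C^k(closure G)], for [G] open: the iterated partial derivatives of order at
   most [k] exist in [G] and extend continuously to the closure of [G]. *)
Fixpoint Ck_closure {R : realType} {n} (G : set 'rV[R]_n) (k : nat)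
    (f : 'rV[R]_n -> R) : Prop :=
  (exists g : 'rV[R]_n -> R,
     {within closure G, continuous g} /\ {in G, f =1 g}) /\
  (if k is k'.+1 then
     forall i : 'I_n, (forall x, G x -> derivable f x (basis_row i)) /\
       Ck_closure G k' (fun x => 'D_(basis_row i) f x)
   else True).

Definition Ck {R : realType} {n} (k : nat) (f : 'rV[R]_n -> R) : Prop :=
  Ck_closure setT k f.

Definition test_function {R : realType} {n} (G : set 'rV[R]_n)
    (phi : 'rV[R]_n -> R) : Prop :=
  (forall k, Ck k phi) /\
  exists K : set 'rV[R]_n,
    [/\ compact K, K `<=` G & forall x, ~ K x -> phi x = 0].

Section Domain.
Context {R : realType} {n : nat}.
Implicit Type G : set 'rV[R]_n.

Definition bdry G : set 'rV[R]_n := closure G `\` interior G.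

Definition graph_fun (i : 'I_n) (sgn : bool) (gamma : 'rV[R]_n.-1 -> R)
    (y : 'rV[R]_n) : R :=
  gamma (col' i y) - (-1) ^+ sgn * y ord0 i.

(* Near [x], up to the choice of the vertical axis [i] and of its orientation,
   [G] is the strict epigraph of the [C^2] function [gamma]. *)
Definition local_C2_graph G (x : 'rV[R]_n) (i : 'I_n) (sgn : bool)
    (gamma : 'rV[R]_n.-1 -> R) : Prop :=
  Ck 2 gamma /\
  \forall y \near x, G y <-> graph_fun i sgn gamma y < 0.

Definition C2_boundary G : Prop :=
  forall x, bdry G x -> exists i sgn gamma, local_C2_graph G x i sgn gamma.

Definition outward_normal G (x v : 'rV[R]_n) : Prop :=
  exists i sgn gamma, local_C2_graph G x i sgn gamma /\
    let w := grad (graph_fun i sgn gamma) x in v = (enorm w)^-1 *: w.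

Definition nu G (x : 'rV[R]_n) : 'rV[R]_n := get (outward_normal G x).

Definition bounded_C2_domain G : Prop :=
  [/\ open G, connected G, G !=set0, bounded_set G & C2_boundary G].

End Domain.

(* A space of functions carried by [fs_mem], with a semi-norm; as in the
   library's [LfunType], elements at distance 0 are not identified. *)
Record fspace (R : realType) := FSpace {
  fs_sort :> lmodType R;
  fs_mem : set fs_sort;
  fs_norm : fs_sort -> R }.
Arguments fs_mem {R}.
Arguments fs_norm {R}.

Definition feq {R : realType} (H : fspace R) (u v : H) : Prop :=
  fs_norm H (u - v) = 0.

Section Spaces.
Context {R : realType}.

Definition L2 d (T : measurableType d) (mu : {measure set T -> \bar R})
    (D : set T) : fspace R :=
  @FSpace R (T -> R)
    [set f : T -> R | measurable_fun D f /\ (\int[mu]_(x in D) ((f x) ^+ 2)%:E < +oo)%E]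
    (fun f => Num.sqrt (\int[mu]_(x in D) (f x) ^+ 2)).

Context {n : nat}.
Variable G : set 'rV[R]_n.

Definition L2G : fspace R := L2 (lebesgue_rV n) G.

Definition dotG (f g : 'rV[R]_n -> R) : R := \int[lebesgue_rV n]_(x in G) (f x * g x).

Definition ess_bound (f : 'rV[R]_n -> R) (M : R) : Prop :=
  \forall x \ae lebesgue_rV n, G x -> `|f x| <= M.

Definition LinfG : fspace R :=
  @FSpace R ('rV[R]_n -> R)
    [set f : 'rV[R]_n -> R | measurable_fun G f /\ exists M, ess_bound f M]
    (fun f => inf [set M | 0 <= M /\ ess_bound f M]).

(* [W^{1,oo}(G; R^n)]: a vector field together with its weak Jacobian matrix,
   the entry [(i, j)] of which is the [j]-th weak partial derivative of the
   [i]-th component. *)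
Definition W1inf_bound (a : ('rV[R]_n -> 'rV[R]_n) * ('rV[R]_n -> 'M[R]_n)) (M : R) :=
  (forall i, ess_bound (fun x => a.1 x ord0 i) M) /\
  (forall i j, ess_bound (fun x => a.2 x i j) M).

Definition W1infG : fspace R :=
  @FSpace R (('rV[R]_n -> 'rV[R]_n) * ('rV[R]_n -> 'M[R]_n))%type
    [set a : (('rV[R]_n -> 'rV[R]_n) * ('rV[R]_n -> 'M[R]_n))%type |
      [/\ forall i, measurable_fun G (fun x => a.1 x ord0 i),
       forall i j, measurable_fun G (fun x => a.2 x i j),
       exists M, W1inf_bound a M
     & forall phi, test_function G phi -> forall i j,
       dotG (fun x => a.1 x ord0 i) (fun x => 'D_(basis_row j) phi x) =
       - dotG (fun x => a.2 x i j) phi]]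
    (fun a => inf [set M | 0 <= M /\ W1inf_bound a M]).

Definition div (a : W1infG) (x : 'rV[R]_n) : R := \tr (a.2 x).

(* [H^1_0(G)]: a function together with its weak gradient, as the closure of
   the pairs [(phi, grad phi)], [phi] a test function, for the [H^1] norm. *)
Definition H1_sq (u : ('rV[R]_n -> R) * ('rV[R]_n -> 'rV[R]_n)) : \bar R :=
  (\int[lebesgue_rV n]_(x in G) ((u.1 x) ^+ 2 + edot (u.2 x) (u.2 x))%:E)%E.

Definition H10 : fspace R :=
  @FSpace R (('rV[R]_n -> R) * ('rV[R]_n -> 'rV[R]_n))%type
    [set u : (('rV[R]_n -> R) * ('rV[R]_n -> 'rV[R]_n))%type |
      [/\ measurable_fun G u.1,
       forall i, measurable_fun G (fun x => u.2 x ord0 i)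
     & exists phi : ('rV[R]_n -> R)^nat, (forall k, test_function G (phi k)) /\
       H1_sq ((phi k, grad (phi k)) - u) @[k --> \oo] --> 0%E]]
    (fun u => Num.sqrt (fine (H1_sq u))).

(* [H^{-1}(G)]: the bounded linear functionals on [H^1_0(G)], with the dual
   norm; the duality pairing is the application. *)
Definition Hm1_bound (l : H10 -> R) (M : R) : Prop :=
  forall u, fs_mem H10 u -> `|l u| <= M * fs_norm H10 u.

Definition Hm1 : fspace R :=
  @FSpace R (H10 -> R)
    [set l : H10 -> R | (forall (c : R) u v, fs_mem H10 u -> fs_mem H10 v ->
                l (c *: u + v) = c * l u + l v) /\ exists M, Hm1_bound l M]
    (fun l => inf [set M | 0 <= M /\ Hm1_bound l M]).

Definition L2_to_Hm1 (f : L2G) : Hm1 := fun u : H10 => dotG f u.1.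

End Spaces.

Section Stochastic.
Context {R : realType} {d : measure_display} {Omega : measurableType d}.
Variable P : probability Omega R.
Variable W : R -> Omega -> R.

(* The natural filtration of [W], augmented by the null sets. *)
Definition filtration (t : R) : set (set Omega) :=
  <<s [set A | (exists s B, [/\ 0 <= s <= t,
                  measurable (B : set (measurableTypeR R)) & A = W s @^-1` B])
               \/ P.-negligible A] >>.

Definition standard_brownian_motion : Prop :=
  [/\ forall t, 0 <= t -> measurable_fun setT (W t : Omega -> measurableTypeR R),
      \forall w \ae P, W 0 w = 0,
      \forall w \ae P, {within `[0, +oo[, continuous (fun t => W t w)},
      forall s t (B : set (measurableTypeR R)), 0 <= s < t -> measurable B ->
        P [set w | B (W t w - W s w)] = normal_prob 0 (Num.sqrt (t - s)) B
    & forall s t A (B : set (measurableTypeR R)), 0 <= s < t ->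
        filtration s A -> measurable B ->
        P (A `&` [set w | B (W t w - W s w)]) =
        (P A * P [set w | B (W t w - W s w)%R])%E ].

(* Strong measurability on [D], with respect to the sigma-algebra [S]: pointwise
   limit of [S]-simple functions. *)
Definition simple_fun (U : Type) (S : set (set U)) (H : fspace R) (s : U -> H) : Prop :=
  exists m (A : 'I_m -> set U) (h : 'I_m -> H),
    (forall i, S (A i) /\ fs_mem H (h i)) /\
    forall u, s u = \sum_i (\1_(A i) u : R) *: h i.

Definition strongly_measurable (U : Type) (S : set (set U)) (D : set U)
    (H : fspace R) (X : U -> H) : Prop :=
  (forall u, D u -> fs_mem H (X u)) /\
  exists s : (U -> H)^nat, (forall k, simple_fun S (s k)) /\
    forall u, D u -> fs_norm H (s k u - X u) @[k --> \oo] --> (0 : R).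

Definition adapted (T : R) (H : fspace R) (X : R -> Omega -> H) : Prop :=
  strongly_measurable (measurable : set (set (measurableTypeR R * Omega)%type))
    (`[0, T] `*` setT) (fun p => X p.1 p.2) /\
  forall t, 0 <= t <= T -> strongly_measurable (filtration t) setT (X t).

Definition E_sq (H : fspace R) (X : Omega -> H) : \bar R :=
  (\int[P]_w ((fs_norm H (X w)) ^+ 2)%:E)%E.

Definition E_sq_int (T : R) (H : fspace R) (X : R -> Omega -> H) : \bar R :=
  (\int[P]_w \int[lebesgue_measure]_(t in `[0%R, T]) ((fs_norm H (X t w)) ^+ 2)%:E)%E.

Definition L2_Ft (t : R) (H : fspace R) (X : Omega -> H) : Prop :=
  strongly_measurable (filtration t) setT X /\ (E_sq X < +oo)%E.

Definition L2_F (T : R) (H : fspace R) (X : R -> Omega -> H) : Prop :=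
  adapted T X /\ (E_sq_int T X < +oo)%E.

Definition Linf_F (T : R) (H : fspace R) (X : R -> Omega -> H) : Prop :=
  adapted T X /\ exists M : R,
    \forall p \ae (@lebesgue_measure R \x P)%E,
      0 <= p.1 <= T -> fs_norm H (X p.1 p.2) <= M.

Definition C_F (T : R) (H : fspace R) (X : R -> Omega -> H) : Prop :=
  [/\ adapted T X,
      forall t, 0 <= t <= T -> (E_sq (X t) < +oo)%E
    & forall t, 0 <= t <= T ->
        E_sq (fun w => X s w - X t w) @[s --> within `[0, T] (nbhs t)] --> 0%E].

(* [X] is in [C^1_F([0,T]; L^2(Omega; H))], with derivative [X']. *)
Definition C1_F (T : R) (H : fspace R) (X X' : R -> Omega -> H) : Prop :=
  [/\ C_F T X, C_F T X'
    & forall t, 0 <= t <= T ->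
        E_sq (fun w => (s - t)^-1 *: (X s w - X t w) - X' t w)
          @[s --> within `[0, T] t^'] --> 0%E].

(* [f] is the elementary process [\sum_i xi_i 1_(theta_i, theta_(i+1)]] on
   [(s, t]], and [I] is its stochastic integral. *)
Definition elementary (s t : R) (f : R -> Omega -> R) (I : Omega -> R) : Prop :=
  exists m (theta : nat -> R) (xi : nat -> Omega -> R),
    [/\ theta 0%N = s /\ theta m = t,
        forall i, (i < m)%N -> theta i <= theta i.+1,
        forall i, (i < m)%N ->
          (forall B : set (measurableTypeR R), measurable B ->
             filtration (theta i) (xi i @^-1` B)) /\
          exists M, forall w, `|xi i w| <= M,
        forall r w, f r w = \sum_(i < m) (\1_`]theta i, theta i.+1] r * xi i w)
      & forall w, I w = \sum_(i < m) xi i w * (W (theta i.+1) w - W (theta i) w)].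

(* [I] is (a version of) the Ito integral of [f] on [(s, t]]. *)
Definition is_ito (s t : R) (f : R -> Omega -> R) (I : Omega -> R) : Prop :=
  measurable_fun setT (I : Omega -> measurableTypeR R) /\
  exists (fk : (R -> Omega -> R)^nat) (Ik : (Omega -> R)^nat),
    [/\ forall k, elementary s t (fk k) (Ik k),
        (\int[P]_w \int[lebesgue_measure]_(r in `[s, t])
           ((fk k r w - f r w) ^+ 2)%:E)%E @[k --> \oo] --> 0%E
      & (\int[P]_w ((Ik k w - I w) ^+ 2)%:E)%E @[k --> \oo] --> 0%E].

End Stochastic.

Section Wave.
Context {R : realType} {n : nat} {d : measure_display} {Omega : measurableType d}.
Variables (P : probability Omega R) (W : R -> Omega -> R).
Variables (G : set 'rV[R]_n) (a : 'rV[R]_n -> 'M[R]_n).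

(* Weak solutions on [(0, tau)] of
     dz = zh dt + Z dW,
     dzh - \sum_(j,k) (a^{jk} z_{x_j})_{x_k} dt = f dt + Zh dW,
   with the homogeneous Dirichlet condition. *)
Definition backward_solution (tau : R) (f : R -> Omega -> L2G G)
    (z Z : R -> Omega -> H10 G) (zh Zh : R -> Omega -> L2G G) : Prop :=
  [/\ [/\ C_F P W tau z, L2_F P W tau Z, C_F P W tau zh, L2_F P W tau Zh
        & L2_F P W tau f],
      forall rho, fs_mem (L2G G) rho -> forall t, 0 <= t <= tau ->
        is_ito P W t tau (fun s w => dotG G (Z s w).1 rho)
          (fun w => dotG G (z tau w).1 rho - dotG G (z t w).1 rho
             - \int[lebesgue_measure]_(s in `[t, tau]) dotG G (zh s w) rho)
    & forall rho, fs_mem (H10 G) rho -> forall t, 0 <= t <= tau ->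
        is_ito P W t tau (fun s w => dotG G (Zh s w) rho.1)
          (fun w => dotG G (zh tau w) rho.1 - dotG G (zh t w) rho.1
             + \int[lebesgue_measure]_(s in `[t, tau])
                 \int[lebesgue_rV n]_(x in G)
                   (\sum_j \sum_k a x j k * (z s w).2 x ord0 j * rho.2 x ord0 k)
             - \int[lebesgue_measure]_(s in `[t, tau]) dotG G (f s w) rho.1)].

Definition L2_surface (D : set 'rV[R]_n) : fspace R :=
  L2 (@surface R n) (D : set (surf_space R n)).

(* [p] is the classical normal derivative on the boundary of the restriction
   to [G] of a [C^2] function. *)
Definition classical_normal_derivative (u : H10 G) (p : L2_surface (bdry G)) : Prop :=
  exists v : 'rV[R]_n -> R,
    [/\ Ck 2 v, {in G, u.1 =1 v} & forall x, bdry G x -> p x = edot (grad v x) (nu G x)].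

(* For a weak solution, [z] takes its values in [H^1_0(G)] only, and its normal
   derivative is defined by density: it is the limit in
   [L^2_F(0, tau; L^2(Gamma))] of the classical normal derivatives of smooth
   solutions, whose terminal data and sources converge to those of [z]. *)
Definition normal_derivative (tau : R) (f : R -> Omega -> L2G G)
    (z : R -> Omega -> H10 G) (zh : R -> Omega -> L2G G)
    (p : R -> Omega -> L2_surface (bdry G)) : Prop :=
  L2_F P W tau p /\
  exists (fk : (R -> Omega -> L2G G)^nat) (zk Zk : (R -> Omega -> H10 G)^nat)
         (zhk Zhk : (R -> Omega -> L2G G)^nat)
         (pk : (R -> Omega -> L2_surface (bdry G))^nat),
    [/\ forall k, backward_solution tau (fk k) (zk k) (Zk k) (zhk k) (Zhk k),
        forall k, L2_F P W tau (pk k) /\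
          forall t w, 0 <= t <= tau -> classical_normal_derivative (zk k t w) (pk k t w),
        E_sq P (fun w => zk k tau w - z tau w) @[k --> \oo] --> 0%E /\
        E_sq P (fun w => zhk k tau w - zh tau w) @[k --> \oo] --> 0%E,
        E_sq_int P tau (fun t w => fk k t w - f t w) @[k --> \oo] --> 0%E
      & E_sq_int P tau (fun t w => pk k t w - p t w) @[k --> \oo] --> 0%E].

Variables (a1 : R -> Omega -> W1infG G) (a2 a3 : R -> Omega -> LinfG G).

Definition dual_source (z Z : R -> Omega -> H10 G) (t : R) (w : Omega) : L2G G :=
  fun x => - edot ((a1 t w).1 x) ((z t w).2 x)
           + (- div (a1 t w) x + a2 t w x) * (z t w).1 x
           + a3 t w x * (Z t w).1 x.

Variables (Gamma0 : set 'rV[R]_n) (T : R).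

(* The controlled system, with [chi] the indicator function of
   [Sigma0 = (0, T) x Gamma0], is
     dy_t - \sum_(j,k) (a^{jk} y_{x_j})_{x_k} dt =
       (a1 . grad y + a2 y + g1) dt + (a3 y + g2) dW   in (0, T) x G,
     y = chi h on (0, T) x Gamma,   y(0) = y0,  y_t(0) = y1.
   A solution [y], with time derivative [yt], is defined by duality with the
   backward equation of source [dual_source]. The random variable [z(0)] being
   F_0-measurable, hence almost surely constant, the identity is required for
   almost all values of it. *)
Definition transposition_solution
    (g1 g2 : R -> Omega -> Hm1 G) (h : R -> Omega -> L2_surface Gamma0)
    (y0 : L2G G) (y1 : Hm1 G)
    (y : R -> Omega -> L2G G) (yt : R -> Omega -> Hm1 G) : Prop :=
  [/\ C_F P W T y,
      C1_F P W T (fun t w => L2_to_Hm1 (y t w)) yt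
    & forall tau, 0 < tau <= T ->
      forall (ztau : Omega -> H10 G) (zhtau : Omega -> L2G G),
        L2_Ft P W tau ztau -> L2_Ft P W tau zhtau ->
      forall (z Z : R -> Omega -> H10 G) (zh Zh : R -> Omega -> L2G G)
             (dz_dnu : R -> Omega -> L2_surface (bdry G)),
        backward_solution tau (dual_source z Z) z Z zh Zh ->
        (\forall w \ae P, feq (z tau w) (ztau w) /\ feq (zh tau w) (zhtau w)) ->
        normal_derivative tau (dual_source z Z) z zh dz_dnu ->
      \forall w0 \ae P,
        \int[P]_w (yt tau w (ztau w)) - y1 (z 0 w0)
        - \int[P]_w dotG G (y tau w) (zhtau w) + dotG G y0 (zh 0 w0) =
        \int[P]_w \int[lebesgue_measure]_(t in `[0, tau]) (g1 t w (z t w))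
        + \int[P]_w \int[lebesgue_measure]_(t in `[0, tau]) (g2 t w (Z t w))
        - \int[P]_w \int[lebesgue_measure]_(t in `[0, tau])
            \int[@surface R n]_(x in Gamma0) (dz_dnu t w x * h t w x)].

Definition exactly_controllable : Prop :=
  forall (y0 : L2G G) (y1 : Hm1 G) (y0' : Omega -> L2G G) (y1' : Omega -> Hm1 G),
    fs_mem (L2G G) y0 -> fs_mem (Hm1 G) y1 ->
    L2_Ft P W T y0' -> L2_Ft P W T y1' ->
  exists (g1 g2 : R -> Omega -> Hm1 G) (h : R -> Omega -> L2_surface Gamma0),
    [/\ L2_F P W T g1, L2_F P W T g2, L2_F P W T h
      & exists (y : R -> Omega -> L2G G) (yt : R -> Omega -> Hm1 G),
          transposition_solution g1 g2 h y0 y1 y yt /\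
          \forall w \ae P, feq (y T w) (y0' w) /\ feq (yt T w) (y1' w)].

End Wave.

(* Main.v *)
(** Pair the state with a fixed test function [phi]. The first component of the
    state has no martingale part: as it is [C^1] in time in
    [L^2(Omega; H^{-1})], its pairing [x(T)] differs from the
    [F_(T-h)]-measurable variable [x(T - h)] by [O(h)] in [L^2(Omega)]. Take as
    target the product of [phi] and the indicator of [W_T > W_0]. On the event
    [|W_(T-h) - W_0| <= sqrt h / 2], of probability at least [c sqrt h], the sign
    of [W_T - W_0] is decided, either way with a probability bounded below, by
    the last Brownian increment, which is independent of [F_(T-h)]. Hence every event
    of [F_(T-h)], in particular [x(T - h) > kappa / 2] with [kappa = |phi|^2],
    differs from the target event with probability at least [c' sqrt h], while
    Markov's inequality bounds this probability by [C h^2]. *)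
Require Import Defs.
From mathcomp Require Import all_boot all_order all_algebra.
From mathcomp Require Import all_classical all_reals all_analysis.
From mathcomp Require Import measurable_realfun ring lra.
Import Order.TTheory GRing.Theory Num.Theory.
Import numFieldNormedType.Exports.
Local Open Scope classical_set_scope.
Local Open Scope ring_scope.

(** * Smooth functions of one variable that vanish where a polynomial is not positive *)

Section flat_bump.
Context {R : realType}.
Implicit Types (p q : {poly R}) (m : nat) (x : R).

(* For fixed [q], the family of these functions is stable under differentiation,
   including at the zeros of [q]. *)
Definition flat_bump q p m x : R :=
  if 0 < q.[x] then p.[x] * q.[x]^-1 ^+ m * expR (- q.[x]^-1) else 0.

(** The numerator of the derivative of [p q^-m exp (-1/q)] over the common denominator [q^(m+2)]. *)
Definition flat_bump_deriv q p m : {poly R} :=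
  p^`() * q ^+ 2 - (p * q^`() * q) *+ m + p * q^`().

Lemma is_derive_flat_bump_pos q p m x : 0 < q.[x] ->
  is_derive x 1 (flat_bump q p m) (flat_bump q (flat_bump_deriv q p m) m.+2 x).
Proof.
move=> qx; have qx0 : q.[x] != 0 by rewrite gt_eqF.
apply: (@near_eq_is_derive _ _ _ (fun y => p.[y] * q.[y]^-1 ^+ m * expR (- q.[y]^-1))).
  near=> y; rewrite /flat_bump ifT//; near: y.
  apply: (cvgr_gt q.[x]) => //; exact: continuous_horner.
rewrite /flat_bump qx.
pose v : R -> R := fun y => q.[y]^-1.
have dV : is_derive x 1 v (- q.[x]^-2 *: q^`().[x]).
  have dq := @derivable_horner R q x.
  apply: DeriveDef; first exact: (@derivableV _ _ (horner q)).
  rewrite (@deriveV _ _ (horner q))//.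
  by congr (_ *: _); exact: derive_val.
have dE : is_derive x 1 (expR \o (- v)) (expR (- v x) * (q.[x]^-2 * q^`().[x])).
  apply: is_derive1_comp.
  by apply: (trigger_derive (is_deriveN dV)); rewrite scaleNr opprK.
have -> : (fun y => p.[y] * q.[y]^-1 ^+ m * expR (- q.[y]^-1)) =
  (horner p * v ^+ m) * (expR \o (- v)).
  by apply/funext => y; rewrite /= !fctE.
apply: trigger_derive.
rewrite /= !fctE /flat_bump_deriv.
rewrite !(hornerD, hornerM, hornerN, hornerMn, hornerXn, horner_exp) /v.
rewrite /GRing.scale /=.
move: {dE dV v} (expR _) => e.
move: (q.[x]) qx0 (p.[x]) (p^`().[x]) (q^`().[x]) => u u0 a b c.
case: m => [|m]; first by rewrite !expr0 !mulr0n; field.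
rewrite -(mulr_natl (a * c * u)) /= !(exprS u^-1).
by move: (u^-1 ^+ m) (m.+1%:R) => w z; field.
Unshelve. all: end_near. Qed.

(** The exponential is at least the single term [u^(n+1) / (n+1)!] of its series. *)
Lemma expX_expRN_le n (u : R) : 0 <= u -> u ^+ n.+1 * expR (- u) <= n.+1`!%:R.
Proof.
move=> u0; rewrite expRN ler_pdivrMr ?expR_gt0//.
rewrite mulrC -ler_pdivrMr ?ltr0n ?fact_gt0//.
by apply: le_trans (expR_ge1Dxn n u0); rewrite lerDr.
Qed.

(** At [y = x] the bound gives [f x = 0], so the difference quotient at step [h] is at most
    [|h| g (x + h)], which tends to 0. *)
Lemma is_derive_quadratic (f g : R -> R) x : {for x, continuous g} ->
  (forall y, `|f y| <= g y * (y - x) ^+ 2) -> is_derive x 1 f 0.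
Proof.
move=> cg fg.
have fx0 : f x = 0.
  by apply/eqP; rewrite -normr_eq0 eq_le normr_ge0 andbT (le_trans (fg x))// subrr expr0n mulr0.
have cvg0 : h^-1 *: ((f \o shift x) (h *: (1 : R)) - f x) @[h --> 0^'] --> (0 : R).
  apply: norm_cvg0.
  have hcvg : `|h| * g (h + x) @[h --> 0^'] --> (0 : R).
    apply: cvg_within_filter.
    suff : `|h| * g (h + x) @[h --> 0] --> `|0 : R| * g (0 + x).
      by rewrite normr0 mul0r.
    apply: cvgM; first exact: norm_continuous.
    apply: (@continuous_comp _ _ _ (shift x) g); last by rewrite /= add0r.
    by apply: cvgD; [exact: cvg_id|exact: cvg_cst].
  apply: (squeeze_cvgr _ (cvg_cst 0) hcvg).
  near=> h; have h0 : h != 0 by near: h; exact: nbhs_dnbhs_neq.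
  rewrite normr_ge0 /= fx0 subr0 /GRing.scale /= mulr1 normrM normfV.
  rewrite ler_pdivrMl ?normr_gt0//; apply: le_trans (fg _) _.
  by rewrite addrK -(real_normK (num_real h)) expr2 mulrC mulrA.
by apply: DeriveDef; [apply/cvg_ex; exists 0 | exact: cvg_lim cvg0].
Unshelve. all: end_near. Qed.

(** Where [q x <= 0], the bound for [is_derive_quadratic] comes from two facts: the exponential
    absorbs [q^-(m+2)], at the cost of [(m+2)!], and leaves a factor [q y ^ 2]; and a positive [q y]
    is at most [q y - q x], a multiple of [y - x]. *)
Lemma is_derive_flat_bump q p m x :
  is_derive x 1 (flat_bump q p m) (flat_bump q (flat_bump_deriv q p m) m.+2 x).
Proof.
have [|qx] := ltP 0 q.[x]; first exact: is_derive_flat_bump_pos.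
rewrite {2}/flat_bump ltNge qx /=.
have /factor_theorem[r qr] : root (q - q.[x]%:P) x.
  by rewrite /root !hornerE subrr.
have qE y : q.[y] - q.[x] = r.[y] * (y - x).
  by have /(congr1 (horner^~ y)) := qr; rewrite !hornerE.
apply: (@is_derive_quadratic _ (fun y => `|p.[y]| * m.+2`!%:R * r.[y] ^+ 2)).
  apply: cvgM; last by under eq_fun do rewrite expr2; apply: cvgM; exact: continuous_horner.
  by apply: cvgM; [apply: cvg_norm; exact: continuous_horner|exact: cvg_cst].
move=> y; rewrite /flat_bump; case: ifPn => qy; last first.
  rewrite normr0; apply: mulr_ge0 (sqr_ge0 _); apply: mulr_ge0 (sqr_ge0 _).
  exact: mulr_ge0.
have u0 : 0 <= q.[y]^-1 by rewrite invr_ge0 ltW.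
have e0 : 0 <= q.[y]^-1 ^+ m * expR (- q.[y]^-1).
  by rewrite mulr_ge0 ?exprn_ge0 ?expR_ge0.
rewrite -2!(mulrA `|p.[y]|) -(mulrA p.[y]) normrM ler_wpM2l// (ger0_norm e0).
rewrite -mulrA.
have -> : q.[y]^-1 ^+ m * expR (- q.[y]^-1) =
    q.[y]^-1 ^+ m.+2 * expR (- q.[y]^-1) * q.[y] ^+ 2.
  by rewrite -addn2 exprD; field; rewrite gt_eqF.
apply: ler_pM => //.
- by rewrite mulr_ge0 ?exprn_ge0 ?expR_ge0.
- exact: sqr_ge0.
- exact: expX_expRN_le.
have qyx : q.[y] <= q.[y] - q.[x] by rewrite lerDl oppr_ge0.
rewrite -exprMn -qE lerXn2r// nnegrE ltW//.
exact: lt_le_trans qy qyx.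
Qed.

Lemma continuous_flat_bump q p m : continuous (flat_bump q p m).
Proof.
move=> x; have [dx _] := is_derive_flat_bump q p m x.
exact/differentiable_continuous/derivable1_diffP.
Qed.

End flat_bump.

(** * Products of one-variable functions of the coordinates *)

Section product_functions.
Context {R : realType} {n : nat}.
Implicit Types (g : 'I_n -> R -> R) (x : 'rV[R]_n).

Definition prod_fun g x : R := \prod_i g i (x ord0 i).

(** On the line through [x] directed by [v], [f] is a translate of [g] times the constant [c], so
    the directional derivative is a one-variable one. *)
Lemma is_derive_line (V : normedModType R) (f : V -> R) (x v : V) (g : R -> R) (t c dg : R) :
  (forall h, f (h *: v + x) = g (h + t) * c) ->
  is_derive t 1 g dg -> is_derive x v f (dg * c).
Proof.
move=> fg [dgt <-].
have cvg0 : h^-1 *: ((f \o shift x) (h *: v) - f x) @[h --> 0^'] --> 'D_1 g t * c.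
  rewrite (_ : (fun h => _) = fun h =>
      (h^-1 *: ((g \o shift t) (h *: (1 : R)) - g t)) * c); last first.
    apply/funext => h /=; rewrite fg -[x in f x]add0r -(scale0r v) fg add0r.
    by rewrite -mulrBl /GRing.scale /= mulr1 mulrA.
  by apply: cvgM; [exact: dgt|exact: cvg_cst].
by apply: DeriveDef; [apply/cvg_ex; eexists; exact: cvg0 | exact: cvg_lim cvg0].
Qed.

Lemma continuous_prod_fun g : (forall i, continuous (g i)) -> continuous (prod_fun g).
Proof.
move=> cg; apply: continuous_big; first exact: mul_continuous.
move=> i _ x; apply: continuous_comp; first exact: coord_continuous.
exact: cg.
Qed.

Lemma is_derive_prod_fun g i (g' : R -> R) x :
  is_derive (x ord0 i) 1 (g i) (g' (x ord0 i)) ->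
  is_derive x (basis_row i) (prod_fun g) (prod_fun (dfwith g i g') x).
Proof.
move=> dg; rewrite /prod_fun (bigD1 i)//= dfwithin.
apply: is_derive_line dg => h; rewrite (bigD1 i)//= !mxE !eqxx mulr1; congr (_ * _).
by apply: eq_bigr => j ji; rewrite !mxE (negbTE ji) andbF mulr0 add0r dfwithout// eq_sym.
Qed.

End product_functions.

(** * Smooth bumps supported in boxes *)

Section test_functions.
Context {R : realType} {n : nat}.
Implicit Types (c x : 'rV[R]_n) (r : R) (i : 'I_n).

(** [S i] is a class of admissible [i]-th factors. Being stable under differentiation, it makes
    every partial derivative a product of the same kind, and induction on [k] applies. *)
Lemma Ck_prod_fun (S : 'I_n -> set (R -> R)) :
  (forall i g, S i g -> exists2 g', S i g' & forall t : R, is_derive t 1 g (g' t)) ->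
  forall k (g : 'I_n -> R -> R), (forall i, S i (g i)) -> Ck k (prod_fun g).
Proof.
move=> SD; have cS (g : 'I_n -> R -> R) : (forall i, S i (g i)) ->
    {within closure setT, continuous (prod_fun g)}.
  move=> Sg; apply: continuous_subspaceT; apply: continuous_prod_fun => i t.
  have [g' _ dg] := SD _ _ (Sg i); have [dt _] := dg t.
  exact/differentiable_continuous/derivable1_diffP.
elim=> [|k IH] g Sg; split=> //; first by exists (prod_fun g); split=> //; exact: cS.
  by exists (prod_fun g); split=> //; exact: cS.
move=> i.
have [g' Sg' dg] := SD _ _ (Sg i).
have dprod (x : 'rV[R]_n) := is_derive_prod_fun _ _ _ _ (dg (x ord0 i)).
split=> [x _|]; first exact: (@ex_derive _ _ _ _ _ _ _ (dprod x)).
rewrite (_ : (fun x => _) = prod_fun (dfwith g i g')); last first.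
  by apply/funext => x; exact: (@derive_val _ _ _ _ _ _ _ (dprod x)).
by apply: IH => j; case: dfwithP.
Qed.

Lemma box_compact c r :
  compact [set x : 'rV[R]_n | forall i, `|x ord0 i - c ord0 i| <= r].
Proof.
have -> : [set x : 'rV[R]_n | forall i, `|x ord0 i - c ord0 i| <= r] =
    [set x : 'rV[R]_n | forall i, `[c ord0 i - r, c ord0 i + r]%classic (x ord0 i)].
  by apply/seteqP; split=> x /= xr i; have := xr i; rewrite /= in_itv /= ler_distl.
apply: (@rV_compact R n (fun i => `[c ord0 i - r, c ord0 i + r]%classic)) => i.
exact: segment_compact.
Qed.

Definition box_poly (c : 'rV[R]_n) (r : R) (i : 'I_n) : {poly R} :=
  (r ^+ 2)%:P - ('X - (c ord0 i)%:P) ^+ 2.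

(** The [i]-th factor is [exp (-1 / (r^2 - (t - c_i)^2))] for [|t - c_i| < r]. Taking a box as
    support, rather than a ball, reduces smoothness to one variable. *)
Definition box_bump (c : 'rV[R]_n) (r : R) : 'rV[R]_n -> R :=
  prod_fun (fun i => flat_bump (box_poly c r i) 1 0).

Lemma box_poly_gt0 c r i t : 0 < r -> (0 < (box_poly c r i).[t]) = (`|t - c ord0 i| < r).
Proof.
move=> r0; rewrite /box_poly !hornerE subr_gt0.
by rewrite -[X in X < _]real_normK ?num_real// ltr_sqr// nnegrE// ltW.
Qed.

Lemma Ck_box_bump k c r : Ck k (box_bump c r).
Proof.
apply: (@Ck_prod_fun (fun i => [set g | exists p m, g = flat_bump (box_poly c r i) p m])).
  move=> i _ [p [m ->]]; pose q := box_poly c r i.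
  exists (flat_bump q (flat_bump_deriv q p m) m.+2).
    by do 2 eexists.
  by move=> t; exact: is_derive_flat_bump.
by move=> i; do 2 eexists.
Qed.

Lemma box_bump_ge0 c r x : 0 <= box_bump c r x.
Proof.
apply: prodr_ge0 => i _; rewrite /flat_bump; case: ifPn => // _.
by rewrite hornerC expr0 !mul1r expR_ge0.
Qed.

Lemma box_bump_le1 c r x : box_bump c r x <= 1.
Proof.
apply: prodr_ile1 => i _; rewrite /flat_bump; case: ifPn => [q0|]; last by rewrite lexx ler01.
rewrite hornerC expr0 !mul1r expR_ge0 expR_le1 oppr_le0 invr_ge0; exact: ltW.
Qed.

Lemma box_bump_eq0 c r x i : 0 < r -> r <= `|x ord0 i - c ord0 i| -> box_bump c r x = 0.
Proof.
move=> r0 xr; rewrite /box_bump /prod_fun (bigD1 i)//=.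
by rewrite /flat_bump box_poly_gt0// ltNge xr mul0r.
Qed.

Lemma box_bump_gt0 c r x : 0 < r ->
  (forall i, `|x ord0 i - c ord0 i| < r) ->
  0 < box_bump c r x.
Proof.
move=> r0 xr; apply: prodr_gt0 => i _; rewrite /flat_bump box_poly_gt0// xr.
by rewrite hornerC expr0 !mul1r expR_gt0.
Qed.

Lemma test_function_box_bump (G : set 'rV[R]_n) c r : 0 < r ->
  [set x : 'rV[R]_n | forall i, `|x ord0 i - c ord0 i| <= r] `<=` G ->
  test_function G (box_bump c r).
Proof.
move=> r0 KG; split=> [k|]; first exact: Ck_box_bump.
eexists; split; [exact: box_compact|exact: KG|].
move=> x /= /existsNP[i /negP]; rewrite -ltNge => /ltW; exact: box_bump_eq0.
Qed.

End test_functions.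

(** * Borel sets and Lebesgue measure on row vectors *)

Section row_measure.
Context {R : realType}.

Lemma measurable_rV_coord n (i : 'I_n) :
  measurable_fun setT (fun y : 'rV[R]_n => y ord0 i : measurableTypeR R).
Proof.
case: n i => [[]//|n i] _ Y mY; rewrite setTI; apply: sub_sigma_algebra.
rewrite -bigcup_mkord_ord; exists i => /=; first exact: ltn_ord.
by exists Y => //; rewrite setTI inord_val.
Qed.

Lemma measurable_rV_box n (A : 'I_n -> set (measurableTypeR R)) :
  (forall i, measurable (A i)) ->
  measurable [set x : 'rV[R]_n | forall i, A i (x ord0 i)].
Proof.
move=> mA; rewrite (_ : [set x | _] =
    \bigcap_(i in [set: 'I_n]) ((fun y : 'rV[R]_n => y ord0 i : measurableTypeR R) @^-1` A i)).
  apply: fin_bigcap_measurable => // i _.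
  by rewrite -[X in measurable X]setTI; exact: measurable_rV_coord.
by apply/seteqP; split=> x /= H i; [move=> _; exact: H|exact: (H i I)].
Qed.

(** The sigma-algebra being generated by the coordinates, [G] is written as the countable union of
    the boxes with rational centre and radius that it contains. *)
Lemma open_rV_measurable n (G : set 'rV[R]_n) : open G -> measurable G.
Proof.
move=> oG.
pose itv (q : {ffun 'I_n -> rat} * rat) i : set (measurableTypeR R) :=
  `]ratr (q.1 i) - ratr q.2, ratr (q.1 i) + ratr q.2[%classic.
pose box q : set 'rV[R]_n := [set x | forall i, itv q i (x ord0 i)].
rewrite (_ : G = \bigcup_q (if `[< box q `<=` G >] then box q else set0)).
  apply: countable_bigcupT_measurable => [|q].
    exact: (@countableP ({ffun 'I_n -> rat} * rat)%type).
  case: ifPn => _; last exact: measurable0.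
  apply: (measurable_rV_box n (itv q)) => i.
  exact: measurable_itv.
apply/seteqP; split=> [x Gx|x [q _]]; last by case: ifPn => // /asboolP; apply.
have [e /= e0 eG] := (nbhs_ballP _ _).1 (open_nbhs_nbhs (conj oG Gx)).
(* A radius below [e / 2] and a centre within that radius of [x] give a box that contains [x] and
   stays in the ball of radius [e]. *)
have [r /andP[r0 re]] : exists r : rat, 0 < (ratr r : R) < e / 2.
  have [|r] := @rat_in_itvoo R 0 (e / 2); first by rewrite divr_gt0.
  by rewrite in_itv /=; exists r.
have ex i : exists q : rat, `|x ord0 i - ratr q| < ratr r.
  have [|q] := @rat_in_itvoo R (x ord0 i - ratr r) (x ord0 i + ratr r).
    by rewrite ltrBlDr -addrA ltrDl addr_gt0.
  by rewrite in_itv /= => xq; exists q; rewrite distrC ltr_distl.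
pose c : {ffun 'I_n -> rat} := [ffun i => projT1 (cid (ex i))].
have cP i : `|x ord0 i - ratr (c i)| < ratr r by rewrite ffunE; case: cid.
have boxE y : box (c, r) y <-> forall i, `|y ord0 i - ratr (c i)| < ratr r.
  by split=> yb i; have := yb i; rewrite /itv /= in_itv /= ltr_distl.
exists (c, r) => //; rewrite ifT; first exact/boxE.
apply/asboolP => y /boxE yb; apply: eG; split=> // i j /=.
rewrite ord1 /ball /= (le_lt_trans (ler_distD (ratr (c j)) _ _))//.
by rewrite (splitr e) ltrD// ?(lt_trans (cP j))// distrC (lt_trans (yb j)).
Qed.

(** Induction along the construction of the measure: a box pulls back to the product of its first
    side and the preimage of a box of one dimension less. In dimension 0 the single point has mass
    1. *)
Lemma lebesgue_rV_box n (A : 'I_n -> set (measurableTypeR R)) :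
  (forall i, measurable (A i)) ->
  (forall i, 0 < lebesgue_measure (A i) < +oo)%E ->
  (0 < lebesgue_rV n [set x : 'rV[R]_n | forall i, A i (x ord0 i)] < +oo)%E.
Proof.
elim: n A => [|n IH] A mA lA.
  rewrite /lebesgue_rV /= /pushforward.
  rewrite (_ : _ @^-1` _ = setT).
    by rewrite diracT lte01 ltry.
  by apply/seteqP; split=> // x _ [].
have /IH : forall i : 'I_n, measurable (A (lift ord0 i)) by [].
move=> /(_ (fun i => lA _)).
rewrite /lebesgue_rV /= /pushforward.
set B := _ @^-1` _ => /andP[B0 Boo].
rewrite (_ : _ @^-1` _ = A ord0 `*` B).
  have /andP[A0 Aoo] := lA ord0.
  rewrite /prod_measure product_measure1E//.
    by rewrite mule_gt0//= lte_mul_pinfty ?measure_ge0 ?ge0_fin_numE.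
  rewrite /B -[X in measurable X]setTI; apply: ps_row_meas => //.
  apply: (measurable_rV_box n (fun i => A (lift ord0 i))) => i; exact: mA.
apply/seteqP; split=> [[t p]/= H|[t p] /= [At H] i].
  by split=> [|i]; [have := H ord0|have := H (lift ord0 i)];
    rewrite mxE ?unlift_none ?liftK.
by rewrite mxE; case: unliftP => [j|] ->; [exact: H|].
Qed.

Lemma measurable_prod_fun n (g : 'I_n -> R -> R) :
  (forall i, continuous (g i)) -> measurable_fun setT (prod_fun g).
Proof.
move=> cg; apply: measurable_prod => i _.
apply: (@measurableT_comp _ _ _ _ _ _ (g i)); last exact: measurable_rV_coord.
exact: continuous_measurable_fun.
Qed.

End row_measure.

(** * Integral inequalities without measurability of the integrand *)

Section lower_integral.
Local Open Scope ereal_scope.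
Context d (T : measurableType d) {R : realType} (mu : {measure set T -> \bar R}).

(* Unlike [ge0_le_integral], no measurability is assumed: the integral of a
   nonnegative function is a supremum over the simple functions below it. *)
Lemma le_integral_nonmeasurable (D : set T) (f g : T -> \bar R) :
  (forall x, D x -> 0 <= f x) -> (forall x, D x -> f x <= g x) ->
  \int[mu]_(x in D) f x <= \int[mu]_(x in D) g x.
Proof.
move=> f0 fg; rewrite !ge0_integralE//; last by move=> x Dx; exact: le_trans (f0 x Dx) (fg x Dx).
apply: le_ereal_sup => _ [h hf <-]; exists h => // x.
apply: le_trans (hf x) _; rewrite /patch; case: ifPn => // xD.
by apply: fg; exact: set_mem.
Qed.

(** Compare [f] with [c] times the indicator of [B]. The intended [f] is a squared norm in [Hm1],
    whose measurability is never established. *)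
Lemma markov_nonmeasurable (f : T -> \bar R) (B : set T) (c : R) :
  measurable B -> (0 <= c)%R -> (forall x, 0 <= f x) -> (forall x, B x -> c%:E <= f x) ->
  c%:E * mu B <= \int[mu]_x f x.
Proof.
move=> mB c0 f0 cf; rewrite -(integral_cst mu mB) (integral_mkcond B).
apply: le_integral_nonmeasurable => x _; rewrite /patch; case: ifPn => //.
by move=> /set_mem; exact: cf.
Qed.

Lemma measurable_norm_ge (f : T -> R) (a : R) :
  measurable_fun setT (f : T -> measurableTypeR R) -> measurable [set x | (a <= `|f x|)%R].
Proof.
move=> mf; rewrite (_ : [set x | _] = (fun x => `|f x|)%R @^-1` `[a, +oo[); last first.
  by apply/seteqP; split=> x /=; rewrite in_itv /= andbT.
rewrite -[X in measurable X]setTI.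
exact: (@measurableT_comp _ _ _ _ _ _ (@Num.norm R R)).
Qed.

End lower_integral.

(** * Lower bounds for Gaussian probabilities *)

Section normal_bounds.
Context {R : realType}.
Implicit Types s a b : R.

(** The value at 2 of the standard normal density, that is, its minimum on [[-2, 2]]. *)
Definition normal_const : R := normal_peak 1 * expR (- 2).

Lemma normal_const_gt0 : 0 < normal_const.
Proof. by rewrite mulr_gt0 ?expR_gt0// normal_peak_gt0. Qed.

(** On [|x| <= 2 s] the density with standard deviation [s] is at least [normal_const / s]. *)
Lemma normal_prob_ge s a b : 0 < s -> a <= b ->
  (forall x, a <= x <= b -> `|x| <= 2 * s) ->
  (((b - a) / s * normal_const)%:E <= normal_prob 0 s `[a, b])%E.
Proof.
move=> s0 ab abs.
have -> : ((b - a) / s * normal_const)%:E = (\int[lebesgue_measure]_(x in `[a, b])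
    (cst (normal_const / s)%:E) x)%E.
  rewrite integral_cst//= lebesgue_measure_itv/= lte_fin.
  have [ab'|] := ltP a b; first by rewrite -EFinB -EFinM; congr (_%:E); ring.
  by move=> ba; rewrite mule0 (le_anti (introT andP (conj ab ba))) subrr !mul0r.
apply: le_integral_nonmeasurable => x /=; rewrite in_itv /= => xab; rewrite lee_fin.
  by rewrite divr_ge0// ltW// normal_const_gt0.
rewrite normal_pdfE ?gt_eqF// /= /normal_fun subr0.
have -> : normal_peak s = normal_peak 1 / s.
  rewrite /normal_peak expr1n -mulrnAr sqrtrM ?sqr_ge0// sqrtr_sqr gtr0_norm//.
  by rewrite invfM mulrnAr mul1r mulrC.
rewrite /normal_const -!mulrA ler_wpM2l ?normal_peak_ge0// mulrC.
rewrite ler_wpM2l ?invr_ge0 ?(ltW s0)// ler_expR.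
rewrite mulNr lerN2 ler_pdivrMr; last by rewrite mulrn_wgt0 ?exprn_gt0.
have : `|x| ^+ 2 <= (2 * s) ^+ 2.
  by rewrite lerXn2r ?nnegrE ?mulr_ge0 ?(ltW s0) ?abs.
by rewrite real_normK ?num_real// exprMn -mulr_natl; lra.
Qed.

End normal_bounds.

(** * The augmented Brownian filtration and the sign of the path *)

Section brownian.
Context {R : realType} {d : measure_display} {Omega : measurableType d}.
Variables (P : probability Omega R) (W : R -> Omega -> R).
Hypothesis cP : measure_is_complete P.
Hypothesis bW : standard_brownian_motion P W.

(** The generators of [filtration], named so that the generated sigma-algebra is a measurable type
    to which the lemmas on measurable functions apply. *)
Definition filtration_gen (t : R) : set (set Omega) :=
  [set A | (exists s B, [/\ 0 <= s <= t,
                  measurable (B : set (measurableTypeR R)) & A = W s @^-1` B])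
               \/ P.-negligible A].

Definition filtration_fun (t : R) (f : Omega -> R) :=
  measurable_fun setT (f : g_sigma_algebraType (filtration_gen t) -> measurableTypeR R).

Lemma filtration_fun_preimage t f (B : set (measurableTypeR R)) :
  filtration_fun t f -> measurable B -> filtration P W t (f @^-1` B).
Proof. by move=> mf mB; rewrite -[_ @^-1` _]setTI; exact: mf. Qed.

(** Completeness of [P] makes the null sets of the augmentation measurable. *)
Lemma filtration_measurable t : filtration P W t `<=` measurable.
Proof.
apply: smallest_sub; first exact: sigma_algebra_measurable.
have [mW _ _ _ _] := bW.
move=> A [[s [B [/andP[s0 _] mB ->]]]|]; last exact: cP.
by rewrite -[X in measurable X]setTI; exact: mW.
Qed.

Lemma filtration_fun_measurable t f : filtration_fun t f ->
  measurable_fun setT (f : Omega -> measurableTypeR R).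
Proof.
move=> mf _ B mB; rewrite setTI; apply: (@filtration_measurable t).
exact: filtration_fun_preimage.
Qed.

Lemma filtration_fun_brownian s t : 0 <= s <= t -> filtration_fun t (W s).
Proof.
move=> st _ B mB; rewrite setTI; apply: sub_sigma_algebra.
by left; exists s, B.
Qed.

Lemma filtration_fun_increment s : 0 <= s -> filtration_fun s (fun w => W s w - W 0 w).
Proof.
by move=> s0; apply: measurable_funB; apply: filtration_fun_brownian; rewrite lexx s0.
Qed.

Lemma filtrationI t A B : filtration P W t A -> filtration P W t B -> filtration P W t (A `&` B).
Proof. exact: (@measurableI _ (g_sigma_algebraType (filtration_gen t))). Qed.

Lemma filtrationC t A : filtration P W t A -> filtration P W t (~` A).
Proof. exact: (@measurableC _ (g_sigma_algebraType (filtration_gen t))). Qed.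

(** Subtracting [W 0], which vanishes only almost surely, makes this an event about an increment,
    whose law is prescribed. *)
Definition up_event (t : R) : set Omega := [set w | 0 < W t w - W 0 w].

Lemma filtration_up_event t : 0 <= t -> filtration P W t (up_event t).
Proof.
move=> t0; rewrite (_ : up_event t = (fun w => W t w - W 0 w) @^-1` `]0, +oo[); last first.
  by apply/seteqP; split=> w /=; rewrite in_itv /= andbT.
by apply: filtration_fun_preimage => //; exact: filtration_fun_increment.
Qed.

(** Split the event [E] that [W s - W 0] is small according to [B]. Outside [B], a last increment of
    at least [sg] puts the path in [up_event]; inside [B], one of at most [- sg] keeps it out.
    Either increment is independent of the past and has probability at least [normal_const], so the
    total is at least [normal_const * P E]. *)
Lemma brownian_sign_far s t B : 0 < s < t -> t - s <= s -> filtration P W s B ->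
  ((normal_const ^+ 2 * (Num.sqrt (t - s) / Num.sqrt s))%:E <=
    P (up_event t `\` B) + P (B `\` up_event t))%E.
Proof.
move=> /andP[s0 st] tss FB; set A := up_event t.
have [mW _ _ nW iW] := bW.
have s0t : 0 <= s < t by rewrite ltW.
have z0s : (0 : R) <= 0 < s by rewrite lexx.
set sg := Num.sqrt (t - s); set ss := Num.sqrt s.
have sg0 : 0 < sg by rewrite sqrtr_gt0 subr_gt0.
have ss0 : 0 < ss by rewrite sqrtr_gt0.
(* This keeps the window defining [E] within two standard deviations of [W s - W 0]. *)
have sgss : sg <= ss by rewrite ler_sqrt// ltW.
pose E := (fun w => W s w - W 0 w) @^-1` `[- (sg / 2), sg / 2].
have FE : filtration P W s E.
  by apply: filtration_fun_preimage => //; apply: filtration_fun_increment; exact: ltW.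
have PE : ((sg / ss * normal_const)%:E <= P E)%E.
  rewrite /E (_ : _ @^-1` _ = [set w | `[- (sg / 2), sg / 2]%classic (W s w - W 0 w)])//.
  rewrite nW//= subr0.
  have {1}-> : sg = sg / 2 - - (sg / 2) by lra.
  apply: normal_prob_ge => //; first by lra.
  by move=> x /andP[x1 x2]; rewrite ler_norml; apply/andP; split; lra.
pose D (I : set R) := [set w | I (W t w - W s w)].
(* For an interval of length [sg], the standard deviation of the last increment, the bound no longer
   depends on [sg]. *)
have PD a b : a <= b -> b - a = sg -> (forall x, a <= x <= b -> `|x| <= 2 * sg) ->
    (normal_const%:E <= P (D `[a, b]%classic))%E.
  move=> ab ba abs; rewrite /D nW//.
  have := normal_prob_ge _ _ _ sg0 ab abs.
  by rewrite ba divff ?gt_eqF// mul1r.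
have iD C a b : filtration P W s C -> P (C `&` D `[a, b]%classic) = (P C * P (D `[a, b]%classic))%E.
  by move=> FC; rewrite iW.
have mFD C a b : filtration P W s C -> measurable (C `&` D `[a, b]%classic).
  move=> FC; apply: measurableI; first exact: filtration_measurable FC.
  rewrite -[X in measurable X]setTI.
  apply: (@measurable_funB _ _ _ _ (W t) (W s)) => //; [|exact: mW (ltW s0)].
  exact/mW/ltW/(lt_trans s0).
have mA : measurable A.
  by apply: (@filtration_measurable t); apply: filtration_up_event; rewrite ltW// (lt_trans s0).
have mB := @filtration_measurable s B FB.
have cst0 : 0 <= normal_const :> R by rewrite ltW// normal_const_gt0.
have le1 : (P (E `&` ~` B) * normal_const%:E <= P (A `\` B))%E.
  have FEB := filtrationI _ _ _ FE (filtrationC _ _ FB).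
  apply: (@le_trans _ _ (P ((E `&` ~` B) `&` D `[sg, 2 * sg]%classic))).
    rewrite iD// lee_wpmul2l//; apply: PD; [lra|lra|].
    by move=> x /andP[x1 x2]; rewrite ler_norml; apply/andP; split; lra.
  apply: le_measure; rewrite ?inE//; [exact: mFD|exact: measurableD|].
  move=> w [[]]; rewrite /E /D /A /up_event /= !in_itv /= => /andP[e1 e2] nB /andP[d1 d2].
  by split=> //; lra.
have le2 : (P (E `&` B) * normal_const%:E <= P (B `\` A))%E.
  have FEB := filtrationI _ _ _ FE FB.
  apply: (@le_trans _ _ (P ((E `&` B) `&` D `[- (2 * sg), - sg]%classic))).
    rewrite iD// lee_wpmul2l//; apply: PD; [lra|lra|].
    by move=> x /andP[x1 x2]; rewrite ler_norml; apply/andP; split; lra.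
  apply: le_measure; rewrite ?inE//; [exact: mFD|exact: measurableD|].
  move=> w [[]]; rewrite /E /D /A /up_event /= !in_itv /= => /andP[e1 e2] nB /andP[d1 d2].
  by split=> //; lra.
apply: le_trans (leeD le1 le2).
rewrite -ge0_muleDl//.
have -> : (P (E `&` ~` B) + P (E `&` B) = P E)%E.
  by rewrite -setDE -measureDI//; exact: filtration_measurable FE.
rewrite [leLHS](_ : _ = ((sg / ss * normal_const)%:E * normal_const%:E)%E).
  by rewrite lee_wpmul2r// lee_fin.
by rewrite -EFinM; congr (_%:E); ring.
Qed.

End brownian.

(** * The dual space [Hm1] and its pairing with [H10] *)

Section functionals.
Context {R : realType} {n : nat}.
Variable G : set 'rV[R]_n.

Lemma fs_norm_H10_ge0 (u : H10 G) : 0 <= fs_norm (H10 G) u.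
Proof. exact: sqrtr_ge0. Qed.

Lemma Hm1_bounds_nonempty (l : Hm1 G) : fs_mem (Hm1 G) l ->
  [set M | 0 <= M /\ Hm1_bound l M] !=set0.
Proof.
move=> [_ [M lM]]; exists `|M|; split=> // v mv; apply: le_trans (lM v mv) _.
by rewrite ler_wpM2r ?fs_norm_H10_ge0 ?ler_norm.
Qed.

Lemma fs_norm_Hm1_ge0 (l : Hm1 G) : fs_mem (Hm1 G) l -> 0 <= fs_norm (Hm1 G) l.
Proof. by move=> ml; apply: lb_le_inf => [|N []//]; exact: Hm1_bounds_nonempty. Qed.

(** The norm of [l] is the infimum of its bounds, each at least [|l u|] over the norm of [u]. If the
    latter norm is 0, any bound already gives [l u = 0]. *)
Lemma Hm1_eval_le (l : Hm1 G) (u : H10 G) : fs_mem (Hm1 G) l -> fs_mem (H10 G) u ->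
  `|l u| <= fs_norm (Hm1 G) l * fs_norm (H10 G) u.
Proof.
move=> ml mu; have [_ [M lM]] := ml.
have [u0|u0] := eqVneq (fs_norm (H10 G) u) 0.
  by have := lM u mu; rewrite u0 !mulr0.
have {}u0 : 0 < fs_norm (H10 G) u by rewrite lt_def u0 fs_norm_H10_ge0.
rewrite -ler_pdivrMr//; apply: lb_le_inf; first exact: Hm1_bounds_nonempty.
by move=> N [N0 lN]; rewrite ler_pdivrMr//; exact: lN.
Qed.

Lemma Hm1_mem0 : fs_mem (Hm1 G) 0.
Proof.
split=> [c u v _ _|]; first by rewrite /= mulr0 addr0.
by exists 0 => u _; rewrite /= normr0 mul0r.
Qed.

Lemma fs_norm_Hm1_0 : fs_norm (Hm1 G) 0 = 0.
Proof.
apply/eqP; rewrite eq_le fs_norm_Hm1_ge0 ?andbT; last exact: Hm1_mem0.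
apply: ge_inf; first by exists 0 => M [].
by split=> // u _; rewrite /= normr0 mul0r.
Qed.

Lemma Hm1_memD (c : R) (l1 l2 : Hm1 G) : fs_mem (Hm1 G) l1 -> fs_mem (Hm1 G) l2 ->
  fs_mem (Hm1 G) (c *: l1 + l2).
Proof.
move=> [lin1 [M1 b1]] [lin2 [M2 b2]]; split=> [a u v mu mv|].
  have E w : (c *: l1 + l2) w = c * l1 w + l2 w by [].
  by rewrite !E lin1// lin2//; ring.
exists (`|c| * M1 + M2) => u mu; have -> : (c *: l1 + l2) u = c * l1 u + l2 u by [].
rewrite mulrDl (le_trans (ler_normD _ _))// lerD ?b2//.
by rewrite normrM -mulrA ler_wpM2l ?b1.
Qed.

Lemma Hm1_memB (l1 l2 : Hm1 G) : fs_mem (Hm1 G) l1 -> fs_mem (Hm1 G) l2 ->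
  fs_mem (Hm1 G) (l1 - l2).
Proof. by move=> m1 m2; rewrite addrC -scaleN1r; exact: Hm1_memD. Qed.

Lemma Hm1_memZ (c : R) (l : Hm1 G) : fs_mem (Hm1 G) l -> fs_mem (Hm1 G) (c *: l).
Proof. by move=> ml; rewrite -[c *: l]addr0; exact: Hm1_memD ml Hm1_mem0. Qed.

Lemma Hm1_eval_sum m (c : 'I_m -> R) (h : 'I_m -> Hm1 G) (u : H10 G) :
  (\sum_i c i *: h i) u = \sum_i c i * h i u.
Proof.
elim/big_ind2 : _ => // l1 x1 l2 x2 <- <-; exact: erefl.
Qed.

Lemma simple_fun_Hm1_mem (U : Type) (S : set (set U)) (s : U -> Hm1 G) :
  simple_fun S s -> forall w, fs_mem (Hm1 G) (s w).
Proof.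
move=> [m [A [h [Sh sE]]]] w; rewrite sE.
apply: (big_ind (fs_mem (Hm1 G))); first exact: Hm1_mem0.
  by move=> l1 l2 m1 m2; rewrite -[l1]scale1r; exact: Hm1_memD.
by move=> i _; apply: Hm1_memZ; exact: (Sh i).2.
Qed.

End functionals.

(** * Measurability of the pairing with a fixed element of [H10] *)

Section strong_measurability.
Context {R : realType} {n : nat} {d : measure_display} {Omega : measurableType d}.
Variables (P : probability Omega R) (W : R -> Omega -> R) (G : set 'rV[R]_n).

(** Pairing with [u] is continuous for the norm of [Hm1], so it turns the simple approximations of
    [X] into real simple functions that converge pointwise. *)
Lemma filtration_fun_eval t (X : Omega -> Hm1 G) (u : H10 G) : fs_mem (H10 G) u ->
  strongly_measurable (filtration P W t) setT X ->
  filtration_fun P W t (fun w => X w u).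
Proof.
move=> mu [mX [s [simp cvs]]].
apply: (@measurable_fun_cvg _ (g_sigma_algebraType (filtration_gen P W t)) R setT
  (fun k w => s k w u)).
  move=> k; have [m [A [h [Sh sE]]]] := simp k.
  under eq_fun do rewrite sE Hm1_eval_sum.
  apply: measurable_sum => i; apply: measurable_funM => //.
  by apply: measurable_indic; exact: (Sh i).1.
move=> w _; apply/cvgrPdist_le => e e0.
(* Adding 1 avoids a division by 0 when the norm of [u] vanishes. *)
have K0 : 0 < fs_norm (H10 G) u + 1 by rewrite ltr_wpDl ?fs_norm_H10_ge0.
have := cvs w I => /cvgrPdist_le /(_ (e / (fs_norm (H10 G) u + 1))) [|N _ HN].
  by rewrite divr_gt0.
exists N => // k Nk; have := HN k Nk; rewrite /= sub0r normrN => sX.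
rewrite distrC; have -> : s k w u - X w u = (s k w - X w) u by [].
have msX : fs_mem (Hm1 G) (s k w - X w).
  by apply: Hm1_memB (mX w I); exact: simple_fun_Hm1_mem (simp k) w.
apply: le_trans (Hm1_eval_le _ _ _ msX mu) _.
apply: (@le_trans _ _ (e / (fs_norm (H10 G) u + 1) * (fs_norm (H10 G) u + 1))).
  apply: ler_pM => //; [exact: fs_norm_Hm1_ge0|exact: fs_norm_H10_ge0| |by rewrite lerDl].
  exact: le_trans (ler_norm _) sX.
by rewrite divfK ?gt_eqF.
Qed.

End strong_measurability.

(** * A differentiable process cannot end at the indicator of the sign of the path *)

Section reachability.
Context {R : realType} {n : nat} {d : measure_display} {Omega : measurableType d}.
Variables (P : probability Omega R) (W : R -> Omega -> R) (G : set 'rV[R]_n).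
Hypothesis cP : measure_is_complete P.
Hypothesis bW : standard_brownian_motion P W.

(** A pairing of size [a] forces a norm of at least [a / K]; apply Markov's inequality to its
    square. *)
Lemma prob_abs_ge_le (Y : Omega -> Hm1 G) (u : H10 G) (a e : R) :
  fs_mem (H10 G) u -> (forall w, fs_mem (Hm1 G) (Y w)) ->
  measurable_fun setT ((fun w => Y w u) : Omega -> measurableTypeR R) ->
  0 < a -> (E_sq P Y <= e%:E)%E ->
  (P [set w | (a <= `|Y w u|)%R] <= (((fs_norm (H10 G) u + 1) / a) ^+ 2 * e)%:E)%E.
Proof.
move=> mu mY measY a0 Ye; set K := fs_norm (H10 G) u + 1.
have K0 : 0 < K by rewrite ltr_wpDl ?fs_norm_H10_ge0.
set B := [set w | _].
have mB : measurable B by exact: measurable_norm_ge.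
have : (((a / K) ^+ 2)%:E * P B <= e%:E)%E.
  apply: le_trans Ye; apply: markov_nonmeasurable => //.
  - exact: sqr_ge0.
  - by move=> w; rewrite lee_fin sqr_ge0.
  move=> w /= aY; rewrite lee_fin lerXn2r ?nnegrE ?fs_norm_Hm1_ge0//.
    by rewrite divr_ge0 ?ltW.
  rewrite ler_pdivrMr// (le_trans aY)// (le_trans (Hm1_eval_le _ _ _ (mY w) mu))//.
  by rewrite ler_wpM2l ?fs_norm_Hm1_ge0// lerDl.
have PB : P B \is a fin_num by rewrite fin_num_measure.
rewrite -[P B](fineK PB) -EFinM !lee_fin => aPe.
rewrite -ler_pdivrMl ?exprn_gt0 ?divr_gt0//.
by rewrite -exprVn invf_div.
Qed.

(** With [h = T - s], [C h^2] is negligible against [k sqrt h] as [h] tends to 0. Writing [h] as a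
    square [sg^2] makes the root explicit. *)
Lemma sqrt_gap (k C T delta : R) : 0 < k -> 0 <= C -> 0 < T -> 0 < delta ->
  exists2 s, [/\ 0 < s < T, T - s <= s & T - s < delta] &
    C * (T - s) ^+ 2 < k * Num.sqrt (T - s).
Proof.
move=> k0 C0 T0 d0.
(* The four entries serve in turn for comparing powers of [sg] with [sg], for [T - s < delta], for
   [T - s <= s] and for [C * sg ^ 3 < k]. *)
pose sg := Num.min (1 / 2) (Num.min (delta / 2) (Num.min (T / 2) (k / (C + 1) / 2))).
have C1 : 0 < C + 1 by rewrite ltr_wpDl.
have sg0 : 0 < sg by rewrite !lt_min !divr_gt0.
have [sg1 sgd sgT sgk] : [/\ sg <= 1 / 2, sg <= delta / 2, sg <= T / 2 & sg <= k / (C + 1) / 2].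
  by split; rewrite !ge_min lexx ?orbT.
have sq : sg ^+ 2 <= sg by rewrite expr2 ler_piMl ?ltW//; lra.
have sq0 : 0 < sg ^+ 2 by rewrite exprn_gt0.
have E : T - (T - sg ^+ 2) = sg ^+ 2 by ring.
exists (T - sg ^+ 2); rewrite E; first by split; [apply/andP; split|..]; lra.
rewrite sqrtr_sqr gtr0_norm//.
have -> : C * (sg ^+ 2) ^+ 2 = C * sg ^+ 3 * sg by ring.
rewrite ltr_pM2r//.
have sgC : (C + 1) * sg < k.
  rewrite mulrC -ltr_pdivlMr// (le_lt_trans sgk)// ltr_pdivrMr// ltr_pMr ?divr_gt0//.
  by rewrite ltr1n.
have : sg ^+ 3 <= sg by rewrite exprS ler_piMr ?ltW//; lra.
nra.
Qed.

(** With [h = T - s], the probability that the event [X s u > kappa / 2] differs from [up_event W T]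
    is bounded below in order [sqrt h] by [brownian_sign_far], and above in order [h^2] by
    [prob_abs_ge_le]. *)
Lemma C1_F_up_event_unreachable (T : R) (X X' : R -> Omega -> Hm1 G) (u : H10 G) (kappa : R) :
  0 < T -> fs_mem (H10 G) u -> 0 < kappa -> C1_F P W T X X' ->
  ~ \forall w \ae P, X T w u = \1_(up_event W T) w * kappa.
Proof.
move=> T0 mu k0 [[[_ aX] _ _] [[_ aX'] sX' _] dX] XT.
have TT : 0 <= T <= T by rewrite ltW/=.
have mX t : 0 <= t <= T -> (forall w, fs_mem (Hm1 G) (X t w)) /\
    measurable_fun setT ((fun w => X t w u) : Omega -> measurableTypeR R).
  move=> tT; have sm := aX t tT; split=> [w|]; first exact: sm.1.
  exact: (filtration_fun_measurable P W cP bW t _ (filtration_fun_eval P W G t (X t) u mu sm)).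
have mX' : (forall w, fs_mem (Hm1 G) (X' T w)) /\
    measurable_fun setT ((fun w => X' T w u) : Omega -> measurableTypeR R).
  have sm := aX' T TT; split=> [w|]; first exact: sm.1.
  exact: (filtration_fun_measurable P W cP bW T _ (filtration_fun_eval P W G T (X' T) u mu sm)).
pose M := fine (E_sq P (X' T)).
have M0 : 0 <= M by apply: fine_ge0; apply: integral_ge0 => w _; rewrite lee_fin sqr_ge0.
have EM : (E_sq P (X' T) <= M%:E)%E.
  rewrite /M fineK// ge0_fin_numE ?sX'//.
  by apply: integral_ge0 => w _; rewrite lee_fin sqr_ge0.
(* Differentiability at [T], with tolerance 1 on the mean square error of the difference
   quotient. *)
have [delta d0 dXlt] : exists2 delta : R, 0 < delta & forall s : R, 0 <= s < T -> T - s < delta ->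
    (E_sq P (fun w => (s - T)^-1 *: (X s w - X T w) - X' T w)%R <= 1%:E)%E.
  have : nbhs (0 : \bar R)%E [set x | (x < 1%:E)%E].
    by apply: open_nbhs_nbhs; split; [exact: open_ereal_lt_ereal|rewrite /= lte_fin].
  move=> /(dX T TT); rewrite /= => -[e /= e0 He]; exists e => // s /andP[s0 sT] sTe.
  apply: ltW; apply: He => /=.
  - by rewrite /ball_ /= ger0_norm// subr_ge0 ltW.
  - by rewrite lt_eqF.
  - by rewrite in_itv /= s0 ltW.
set K := fs_norm (H10 G) u + 1.
have K0 : 0 < K by rewrite ltr_wpDl ?fs_norm_H10_ge0.
(* With [a = kappa / (4 h)] as chosen below, [C * h ^ 2] is twice the sum of the bounds for [D] and
   [X' T]; the factor 2 counts the two differences of events. *)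
pose C := 2 * ((K / (kappa / 4)) ^+ 2 * 1 + (K / (kappa / 4)) ^+ 2 * M).
(* As [s] is not known yet, the [sqrt s] of the lower bound is replaced by the larger [sqrt T]. *)
have [||||s [/andP[s0 sT] hs hd] Cs] :=
    sqrt_gap (normal_const ^+ 2 / Num.sqrt T) C T delta => //.
- by rewrite divr_gt0 ?exprn_gt0 ?normal_const_gt0 ?sqrtr_gt0.
- by rewrite mulr_ge0// addr_ge0// mulr_ge0// sqr_ge0.
set h := T - s in hs hd Cs; have h0 : 0 < h by rewrite subr_gt0.
have sTT : 0 <= s <= T by rewrite !ltW.
have [mXs measXs] := mX s sTT; have [mXT measXT] := mX T TT; have [mX'T measX'T] := mX'.
pose D w := (s - T)^-1 *: (X s w - X T w) - X' T w.
have DE w : D w u = (s - T)^-1 * (X s w u - X T w u) - X' T w u by [].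
have mD w : fs_mem (Hm1 G) (D w).
  by apply: Hm1_memB => //; apply: Hm1_memZ; exact: Hm1_memB.
have measD : measurable_fun setT ((fun w => D w u) : Omega -> measurableTypeR R).
  under eq_fun do rewrite DE; apply: measurable_funB => //; apply: measurable_funM => //.
  exact: measurable_funB.
pose a := kappa / (4 * h); have a0 : 0 < a by rewrite divr_gt0// mulr_gt0.
have PD := prob_abs_ge_le D u a 1 mu mD measD a0 (dXlt s _ hd).
have PX' := prob_abs_ge_le (X' T) u a M mu mX'T measX'T a0 EM.
have {}PD := PD ltac:(by rewrite ltW).
set BD := [set w | _] in PD; set BX := [set w | _] in PX'.
(* The threshold is the midpoint of the values 0 and [kappa] of [X T w u], so a wrong guess means a
   gap of at least [kappa / 2]. *)
pose B := (fun w => X s w u) @^-1` `]kappa / 2, +oo[.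
have FB : filtration P W s B.
  apply: filtration_fun_preimage => //.
  exact: (filtration_fun_eval P W G s (X s) u mu (aX s sTT)).
have [N [mN N0 XTN]] := XT.
(* If the pairings of [D] and [X' T] with [u] both stay below [a], those of [X s] and [X T] differ
   by less than [2 a h = kappa / 2]. *)
have gap w : kappa / 2 <= `|X s w u - X T w u| -> (BD `|` BX) w.
  move=> gw; apply: contrapT => /not_orP[/negP + /negP]; rewrite -!ltNge DE => Dw Xw.
  have : `|(s - T)^-1 * (X s w u - X T w u)| < a + a.
    rewrite -[X in `|X|](subrK (X' T w u)) (le_lt_trans (ler_normD _ _))//.
    exact: ltrD.
  rewrite normrM normfV -opprB normrN -/h (gtr0_norm h0) mulrC ltr_pdivrMr//.
  rewrite ltNge => /negP; apply; apply: le_trans gw.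
  by rewrite /a le_eqVlt; apply/orP; left; apply/eqP; field; rewrite gt_eqF.
have XTE w : ~ N w -> X T w u = \1_(up_event W T) w * kappa.
  by move=> nN; apply: contrapT => H; apply: nN; exact: XTN.
have sub1 : up_event W T `\` B `<=` (BD `|` BX) `|` N.
  move=> w [Aw]; rewrite /B /= in_itv /= andbT => /negP; rewrite -leNgt => Xw.
  have [Nw|nN] := pselect (N w); [by right|left].
  apply: gap; rewrite (XTE w nN) indicE mem_set// mul1r distrC ler_normr.
  by apply/orP; left; lra.
have sub2 : B `\` up_event W T `<=` (BD `|` BX) `|` N.
  move=> w []; rewrite {1}/B /= in_itv /= andbT => Xw nA.
  have [Nw|nN] := pselect (N w); [by right|left].
  apply: gap; rewrite (XTE w nN) indicE memNset// mul0r subr0 ler_normr.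
  by apply/orP; left; exact: ltW.
have mBX : measurable (BX : set Omega) by exact: measurable_norm_ge.
have mBD : measurable (BD : set Omega) by exact: measurable_norm_ge.
have mA : measurable (up_event W T).
  by apply: (filtration_measurable P W cP bW T); apply: filtration_up_event; rewrite ltW.
have mB : measurable B by exact: (filtration_measurable P W cP bW s).
have bound (E : set Omega) : measurable E -> E `<=` (BD `|` BX) `|` N ->
    (P E <= ((K / a) ^+ 2 * 1 + (K / a) ^+ 2 * M)%:E)%E.
  move=> mE sE.
  apply: (@le_trans _ _ (P ((BD `|` BX) `|` N))).
    by apply: le_measure; rewrite ?inE//; do 2?apply: measurableU.
  apply: le_trans (measureU2 _ _ _) _ => //; first exact: measurableU.
  rewrite [X in (_ + X <= _)%E](N0 : _ = 0%E) adde0; apply: le_trans (measureU2 _ _ _) _ => //.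
  by rewrite EFinD; exact: leeD.
have := brownian_sign_far P W cP bW s T B (introT andP (conj s0 sT)) hs FB.
move=> /le_trans /(_ (leeD (bound _ (measurableD mA mB) sub1) (bound _ (measurableD mB mA) sub2))).
rewrite -EFinD lee_fin leNgt => /negP; apply.
have Ka : K / a = K / (kappa / 4) * h by rewrite /a; field; rewrite !gt_eqF.
rewrite Ka; apply: le_lt_trans (lt_le_trans Cs _).
  by rewrite /C le_eqVlt; apply/orP; left; apply/eqP; ring.
rewrite -/h -mulrA ler_wpM2l ?sqr_ge0// mulrC ler_wpM2l ?sqrtr_ge0//.
by rewrite lef_pV2 ?posrE ?sqrtr_gt0// ler_sqrt// ltW.
Qed.

End reachability.

(** * The bump as an element of [L2G] and of [H10] *)

Section bump_spaces.
Context {R : realType} {n : nat}.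
Variables (G : set 'rV[R]_n) (c : 'rV[R]_n) (r : R).
Hypothesis oG : open G.
Hypothesis r0 : 0 < r.
Hypothesis boxG : [set x : 'rV[R]_n | forall i, `|x ord0 i - c ord0 i| <= r] `<=` G.

Let phi := box_bump c r.

Lemma measurable_box_bump : measurable_fun setT phi.
Proof.
by apply: measurable_prod_fun => i; exact: continuous_flat_bump.
Qed.

(** Differentiation replaces the [i]-th factor by another flat bump, so the result is still a
    product of continuous factors. *)
Lemma measurable_grad_box_bump i : measurable_fun setT (fun x => grad phi x ord0 i).
Proof.
pose q j := box_poly c r j; pose g j := flat_bump (q j) 1 0.
pose g' := flat_bump (q i) (flat_bump_deriv (q i) 1 0) 2.
rewrite (_ : (fun x => _) = prod_fun (dfwith g i g')).
  by apply: measurable_prod_fun => j; case: dfwithP => [|k _]; exact: continuous_flat_bump.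
apply/funext => x; rewrite mxE.
have [_ <-] := is_derive_prod_fun g i g' x (is_derive_flat_bump (q i) 1 0 (x ord0 i)).
by [].
Qed.

Lemma H10_mem_box_bump : fs_mem (H10 G) (phi, grad phi).
Proof.
split=> /=; [exact: measurable_funTS measurable_box_bump| |].
  by move=> i; exact: measurable_funTS (measurable_grad_box_bump i).
exists (fun=> phi); split=> [_|]; first exact: test_function_box_bump.
rewrite subrr (_ : H1_sq _ _ = 0%E); first exact: cvg_cst.
rewrite /H1_sq; apply: integral0_eq => x _.
by rewrite /= expr0n /edot big1 ?addr0// => i _; rewrite mxE mul0r.
Qed.

Let box := [set x : 'rV[R]_n | forall i, `|x ord0 i - c ord0 i| < r].

Let boxE : box = [set x : 'rV[R]_n |
  forall i, `]c ord0 i - r, c ord0 i + r[%classic (x ord0 i)].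
Proof.
by apply/seteqP; split=> x /= xr i; have := xr i; rewrite /= in_itv /= ltr_distl.
Qed.

Let mbox : measurable box.
Proof.
rewrite boxE; apply: (measurable_rV_box n (fun i => `]c ord0 i - r, c ord0 i + r[%classic)).
by move=> i; exact: measurable_itv.
Qed.

Let lebesgue_box : (0 < lebesgue_rV n box < +oo)%E.
Proof.
rewrite boxE; apply: (lebesgue_rV_box n (fun i => `]c ord0 i - r, c ord0 i + r[%classic)) => i.
  exact: measurable_itv.
have crr : c ord0 i - r < c ord0 i + r by rewrite ltrD2l gtrN.
by rewrite lebesgue_measure_itv /= lte_fin crr -EFinB lte_fin ltry andbT subr_gt0.
Qed.

Let mG : measurable G. Proof. exact: open_rV_measurable. Qed.

Let mphi : measurable_fun G phi. Proof. exact: measurable_funTS measurable_box_bump. Qed.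

(** The square is at most the indicator of the open box, which has finite measure. *)
Lemma L2G_mem_box_bump : fs_mem (L2G G) phi.
Proof.
split=> //=; have /andP[_ /(le_lt_trans _)] := lebesgue_box; apply.
apply: (@le_trans _ _ (lebesgue_rV n (box `&` G))).
  rewrite -integral_indic//; apply: le_integral_nonmeasurable => x Gx; rewrite lee_fin.
    exact: sqr_ge0.
  rewrite indicE; case: (boolP (x \in _)) => [_|/negP xB].
    by rewrite exprn_ile1 ?box_bump_ge0 ?box_bump_le1.
  have /existsNP[i /negP] : ~ box x by move=> H; apply: xB; rewrite inE.
  by rewrite -leNgt => xr; rewrite /phi (box_bump_eq0 c r x i)// expr0n.
by apply: le_measure; rewrite ?inE//; exact: measurableI.
Qed.

(** Otherwise the bump would vanish almost everywhere in [G], whereas it is positive on a box of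
    positive measure. *)
Lemma dotG_box_bump_gt0 : 0 < dotG G phi phi.
Proof.
have [_ fin] := L2G_mem_box_bump.
have ge0 : (0 <= \int[lebesgue_rV n]_(x in G) (phi x * phi x)%:E)%E.
  by apply: integral_ge0 => x _; rewrite lee_fin -expr2 sqr_ge0.
apply: fine_gt0; rewrite fin andbT lt_def ge0 andbT; apply/eqP => int0.
have mphi2 : measurable_fun G (fun x => (phi x * phi x)%:E).
  by apply/measurable_EFinP; exact: measurable_funM.
have /(ae_eq_integral_abs _ mG mphi2).1 : (\int[lebesgue_rV n]_(x in G) `|(phi x * phi x)%:E| = 0)%E.
  rewrite -int0; apply: eq_integral => x _.
  by rewrite gee0_abs// lee_fin -expr2 sqr_ge0.
move=> [N [mN N0 subN]].
have /andP[+ _] := lebesgue_box; rewrite lt_def => /andP[/eqP + _]; apply.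
apply: (subset_measure0 mbox mN _ N0) => x xr; apply: subN => /= phi0.
have Gx : G x by apply: boxG => i; exact/ltW/xr.
have [/eqP] := phi0 Gx; rewrite mulf_eq0 orbb gt_eqF//.
exact: box_bump_gt0.
Qed.

End bump_spaces.

(** * Compatibility of the scalar product with equality in [L2G] *)

Section dot_congruence.
Context {R : realType} {n : nat}.
Variable G : set 'rV[R]_n.
Hypothesis mG : measurable G.

(** Functions at distance 0 are not identified, but they agree almost everywhere in [G]. *)
Lemma feq_dotG (f g : L2G G) (phi : 'rV[R]_n -> R) : fs_mem (L2G G) f -> fs_mem (L2G G) g ->
  measurable_fun G phi -> feq f g -> dotG G f phi = dotG G g phi.
Proof.
move=> [mf f2] [mg g2] mphi fg.
have mB2 : measurable_fun G (fun x => (((f : 'rV[R]_n -> R) - g) x ^+ 2)%:E).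
  by apply/measurable_EFinP/measurable_funX; exact: measurable_funB.
have m2 (h : 'rV[R]_n -> R) : measurable_fun G h ->
    measurable_fun G (fun x => (2%:E * (h x ^+ 2)%:E)%E).
  by move=> mh; apply/measurable_EFinP/measurable_funM => //; exact: measurable_funX.
have ge0 : (0 <= \int[lebesgue_rV n]_(x in G) (((f : 'rV[R]_n -> R) - g) x ^+ 2)%:E)%E.
  by apply: integral_ge0 => x _; rewrite lee_fin sqr_ge0.
(* The norm goes through [fine], which sends [+oo] to 0, so a zero norm gives a zero integral only
   once finiteness is known. It follows from [(f - g)^2 <= 2 f^2 + 2 g^2]. *)
have fin : (\int[lebesgue_rV n]_(x in G) (((f : 'rV[R]_n -> R) - g) x ^+ 2)%:E < +oo)%E.
  apply: (@le_lt_trans _ _ (\int[lebesgue_rV n]_(x in G)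
      (2%:E * ((f x) ^+ 2)%:E + 2%:E * ((g x) ^+ 2)%:E)%E)%E).
    apply: le_integral_nonmeasurable => x _; first by rewrite lee_fin sqr_ge0.
    rewrite -!EFinM -EFinD lee_fin; have := sqr_ge0 (f x + g x).
    by have -> : (f - g) x = f x - g x by []; nra.
  rewrite ge0_integralD//; first last.
  - exact: m2.
  - by move=> x _; rewrite mule_ge0// lee_fin sqr_ge0.
  - exact: m2.
  - by move=> x _; rewrite mule_ge0// lee_fin sqr_ge0.
  have mE (h : 'rV[R]_n -> R) : measurable_fun G h -> measurable_fun G (fun x => (h x ^+ 2)%:E).
    by move=> mh; apply/measurable_EFinP/measurable_funX.
  rewrite !ge0_integralZl//; try by [exact: mE|move=> x _; rewrite lee_fin sqr_ge0].
  by rewrite lte_add_pinfty// lte_mul_pinfty// ?lee_fin.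
have int0 : (\int[lebesgue_rV n]_(x in G) (((f : 'rV[R]_n -> R) - g) x ^+ 2)%:E = 0)%E.
  move: fg; rewrite /feq /= /Rintegral => /eqP; rewrite sqrtr_eq0 => le0.
  apply/eqP; rewrite eq_le ge0 andbT.
  by rewrite -(ge0_fin_numE ge0) in fin; rewrite -(fineK fin) lee_fin.
have /(ae_eq_integral_abs _ mG mB2).1 fg0 : (\int[lebesgue_rV n]_(x in G)
    `|(((f : 'rV[R]_n -> R) - g) x ^+ 2)%:E| = 0)%E.
  rewrite -int0; apply: eq_integral => x _.
  by rewrite gee0_abs// lee_fin sqr_ge0.
congr fine; apply: ae_eq_integral => //.
- by apply/measurable_EFinP; exact: measurable_funM.
- by apply/measurable_EFinP; exact: measurable_funM.
apply: filterS fg0 => x /[apply] /eqP; rewrite eqe sqrf_eq0 => /eqP.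
by have -> : (f - g) x = f x - g x by []; move=> /subr0_eq ->.
Qed.

End dot_congruence.

(** * Square integrability and measurability of the target states *)

Section target.
Context {R : realType} {n : nat} {d : measure_display} {Omega : measurableType d}.
Variables (P : probability Omega R) (W : R -> Omega -> R).

Lemma E_sq_bounded (H : fspace R) (X : Omega -> H) (M : R) :
  (forall w, (fs_norm H (X w)) ^+ 2 <= M) -> (E_sq P X < +oo)%E.
Proof.
move=> XM; apply: (@le_lt_trans _ _ (\int[P]_w cst M%:E w)%E).
  by apply: le_integral_nonmeasurable => w _; rewrite lee_fin ?sqr_ge0.
by rewrite integral_cst//= probability_setT mule1 ltry.
Qed.

Lemma L2_Ft_indic (t : R) (H : fspace R) (A : set Omega) (h : H) :
  filtration P W t A -> fs_mem H h -> fs_mem H 0 ->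
  fs_norm H 0 = 0 -> L2_Ft P W t (fun w => (\1_A w : R) *: h).
Proof.
move=> FA mh m0 n0; split.
  split=> [w _|]; first by rewrite indicE; case: (w \in A); rewrite ?scale1r ?scale0r.
  exists (fun=> fun w => (\1_A w : R) *: h); split=> [_|w _].
    by exists 1%N, (fun=> A), (fun=> h); split=> // w; rewrite big_ord1.
  by rewrite subrr n0; exact: cvg_cst.
apply: (@E_sq_bounded _ _ ((fs_norm H h) ^+ 2)) => w; rewrite indicE.
by case: (w \in A); rewrite ?scale1r// scale0r n0 expr0n sqr_ge0.
Qed.

End target.

(** * A target state that no controls reach *)

Theorem theorem2p1 (R : realType) (n : nat)
    (d : measure_display) (Omega : measurableType d) (P : probability Omega R)
    (W : R -> Omega -> R) (G : set 'rV[R]_n) (a : 'rV[R]_n -> 'M[R]_n) (T : R)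
    (a1 : R -> Omega -> W1infG G) (a2 a3 : R -> Omega -> LinfG G)
    (Gamma0 : set 'rV[R]_n) :
  (0 < n)%N ->
  measure_is_complete P ->
  standard_brownian_motion P W ->
  bounded_C2_domain G ->
  (forall j k : 'I_n, Ck_closure G 3 (fun x => a x j k)) ->
  (forall x, G x -> forall j k : 'I_n, a x j k = a x k j) ->
  (exists s0 : R, 0 < s0 /\ forall x, G x -> forall xi : 'rV[R]_n,
     s0 * edot xi xi <= \sum_j \sum_k a x j k * xi ord0 j * xi ord0 k) ->
  0 < T ->
  Linf_F P W T a1 -> Linf_F P W T a2 -> Linf_F P W T a3 ->
  Gamma0 `<=` bdry G -> Gamma0 !=set0 ->
  surface_measurable Gamma0 ->
  ~ exactly_controllable P W a a1 a2 a3 Gamma0 T.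
Proof.
move=> _ cP bW [oG _ [c Gc] _ _] _ _ _ T0 _ _ _ _ _ _ control.
(* Balls are those of the sup norm, so halving the radius puts a closed box inside [G]. *)
have [e e0 boxG] : exists2 e : R, 0 < e &
    [set x : 'rV[R]_n | forall i, `|x ord0 i - c ord0 i| <= e] `<=` G.
  have [e /= e0 eG] := (nbhs_ballP _ _).1 (open_nbhs_nbhs (conj oG Gc)).
  exists (e / 2) => [|x xe]; first by rewrite divr_gt0.
  apply: eG; split=> // i j; rewrite ord1 /ball /= distrC (le_lt_trans (xe j))//.
  by rewrite ltr_pdivrMr// ltr_pMr// ltr1n.
have mG := open_rV_measurable n G oG.
pose phi := box_bump c e.
have mphi := L2G_mem_box_bump G c e oG e0.
have mrho := H10_mem_box_bump G c e e0 boxG.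
have kappa0 := dotG_box_bump_gt0 G c e oG e0 boxG.
have int0 : (\int[lebesgue_rV n]_(x in G) (((0 : L2G G) x) ^+ 2)%:E = 0)%E.
  by apply: integral0_eq => x _; rewrite /= expr0n.
have norm0 : fs_norm (L2G G) 0 = 0.
  by rewrite /= /Rintegral int0 sqrtr0.
have mem0 : fs_mem (L2G G) 0.
  split=> /=; first exact: measurable_cst.
  by rewrite int0 ltry.
have FA : filtration P W T (up_event W T) by apply: filtration_up_event; rewrite ltW.
have Ltarget := L2_Ft_indic P W T (L2G G) (up_event W T) phi FA mphi mem0 norm0.
(* The velocity target is 0, written as an indicator times 0 so that the same lemma applies. *)
have Lzero := L2_Ft_indic P W T (Hm1 G) (up_event W T) 0 FA (Hm1_mem0 G) (Hm1_mem0 G)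
  (fs_norm_Hm1_0 G).
have [g1 [g2 [h [_ _ _ [y [yt [[[[_ ay] _ _] C1y _] yT]]]]]]] :=
  control 0 0 _ _ mem0 (Hm1_mem0 G) Ltarget Lzero.
have TT : 0 <= T <= T by rewrite ltW/=.
have my := (ay T TT).1.
(* Paired with the bump, the state at [T] would be [kappa = dotG G phi phi] on [up_event W T] and 0
   elsewhere. *)
apply: (C1_F_up_event_unreachable P W G cP bW T _ _ _ _ T0 mrho kappa0 C1y).
apply: filterS yT => w [yw _].
have -> : L2_to_Hm1 (y T w) (phi, grad phi) = dotG G (y T w) phi by [].
rewrite (feq_dotG G mG _ _ phi (my w I) _ mphi.1 yw) indicE.
  case: (w \in _); first by rewrite scale1r mul1r.
  rewrite scale0r mul0r /dotG /Rintegral (_ : integral _ _ _ = 0%E)//.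
  by apply: integral0_eq => x _; rewrite mul0r.
by case: (w \in _); rewrite ?scale1r ?scale0r.
Qed.
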